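(* Let $M$ be a nonstandard model of the superstructure $\mathcal{S}$ over $\mathbf{R}$ and let $\varepsilon\in{}^*\mathbf{R}_M$ be a positive infinitesimal. Then there exists a model $M'$ of $\mathcal{S}$ which is an elementary extension of $M$ such that the space $\mathcal{F}_M$ (for $M$ and $\varepsilon$) embeds isometrically into the asymptotic space $\mathcal{H}_{0,M'}$ of the Lobachevsky plane (for $M'$ and the same $\varepsilon$, regarded as an element of ${}^*\mathbf{R}_{M'}$).
   Context: Models. Let $S_0=\mathbf{R}$ (treated as individuals), $S_{i+1}=S_i\cup\mathcal{P}(S_i)$ and $\mathcal{S}=\bigcup_{i}S_i$ (the superstructure). Consider bounded first-order formulas (every variable ranges over some entity, i.e. over some element of $\mathcal{S}\setminus S_0$) in the language with $=$, $\in$ and a constant for each element of $\mathcal{S}$. A nonstandard model $M=(A,E,I)$ of $\mathcal{S}$ is a structure containing $\mathcal{S}$ via an injection $x\mapsto{}^*x$, with relations $E$, $I$ extending $=$ and $\in$, in which exactly the bounded sentences true in $\mathcal{S}$ are true (transfer), and such that the field ${}^*\mathbf{R}={}^*\mathbf{R}_M$ is a proper extension of $\mathbf{R}$. A model $M'=(A',E',I')$ is an elementary extension of $M$ if $A\subset A'$ and every bounded formula with parameters from $A$ that is true in $M$ is true in $M'$; then ${}^*\mathbf{R}_M\subset{}^*\mathbf{R}_{M'}$. A number $a\in{}^*\mathbf{R}$ is finite if $|a|<K$ for some $K\in\mathbf{R}$; its standard part $\operatorname{st}(a)\in\mathbf{R}$ is the unique real infinitely close to $a$. Asymptotic space (for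 a model $M$ and a positive infinitesimal $\varepsilon$). The Lobachevsky plane $\mathcal{H}=(H,d)$ (curvature $-1$) is described in polar coordinates $(\rho,\varphi)$, $\rho\ge0$ (the distance to the origin), $\varphi\in S^1$, by $\cosh d(x_1,x_2)=\cosh\rho_1\cosh\rho_2-\sinh\rho_1\sinh\rho_2\cos(\varphi_1-\varphi_2)$. Its nonstandard extension is $({}^*H,{}^*d)$. Let $Y=\{(\rho,\varphi)\in{}^*H:\varepsilon\rho\text{ is finite}\}$. The asymptotic space $\mathcal{H}_{0,M}$ is the metric space $Y/{\approx}$ with distance $\operatorname{st}(\varepsilon\cdot{}^*d(x,y))$, where $x\approx y$ iff $\varepsilon\cdot{}^*d(x,y)$ is infinitesimal. The space $\mathcal{F}_M$. Fix a well-ordering $\prec$ of ${}^*\mathbf{R}={}^*\mathbf{R}_M$ given by a bijection with the least ordinal of cardinality $|{}^*\mathbf{R}|$. For nonzero $x,y\in{}^*\mathbf{R}$ write $x\sim y$ if both $x/y$ and $y/x$ are finite. Let $\Lambda=({}^*\mathbf{R}\setminus\{0\})/{\sim}$, let $\lambda(x)$ be the class of $x$, and order $\Lambda$ by: $\lambda(x)<\lambda(y)$ iff $\lambda(x)\ne\lambda(y)$ and $|x|<|y|$. Let $\lambda^0=\lambda(1)$, $a_{\lambda^0}=1$, and for $\lambda\neq\lambda^0$ let $a_\lambda$ be the $\prec$-minimal element of $\lambda$. For $\lambda\le\lambda^0$ let $g(\lambda)=\operatorname{st}(-\varepsilon\log|a_\lambda|)\in[0,\infty]$ ($+\infty$ if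 $-\varepsilon\log|a_\lambda|$ is infinite). Consider pairs $(f,\lambda_1)$ where $\lambda_1\in\Lambda$, $\lambda_1\le\lambda^0$, $g(\lambda_1)<\infty$, and $f$ is a function on $\{\lambda\in\Lambda:\lambda_1\le\lambda\le\lambda^0\}$ with $f(\lambda^0)\in S^1=\mathbf{R}/2\pi\mathbf{Z}$, $f(\lambda)\in\mathbf{R}$ for $\lambda<\lambda^0$, and $f(\lambda)=0$ outside a set $\Sigma_f$ that is well ordered with respect to the reverse of the order of $\Lambda$ and satisfies $|\Sigma_f|<|{}^*\mathbf{R}|$. Put $$\delta((f_1,\lambda_1),(f_2,\lambda_2))=(g(\lambda_1)-\tilde g)+(g(\lambda_2)-\tilde g),$$ $$\tilde g=\sup\{h\in\mathbf{R}: f_1(\lambda)=f_2(\lambda)\text{ for all }\lambda\le\lambda^0\text{ such that }g(\lambda)<h\},$$ where ''$f_1(\lambda)=f_2(\lambda)$'' means that both are defined at $\lambda$ and equal. $\mathcal{F}_M$ is the metric space obtained from the set of these pairs with $\delta$ by identifying pairs at $\delta$-distance $0$. *)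

(* Defs.v *)
From HB Require Import structures.
From mathcomp Require Import all_boot all_order all_algebra.
From mathcomp Require Import all_classical all_reals all_analysis.

Set Implicit Arguments.
Unset Strict Implicit.
Unset Printing Implicit Defensive.
Import Order.TTheory GRing.Theory Num.Theory.
Local Open Scope classical_set_scope.
Local Open Scope card_scope.
Local Open Scope ring_scope.

(* The set of classes of [r], which is meant to be an equivalence relation. *)
Definition quo {X : Type} (r : X -> X -> Prop) : Type :=
  {P : set X | exists x, P = r x}.
Definition cls {X : Type} (r : X -> X -> Prop) (x : X) : quo r :=
  exist _ (r x) (ex_intro _ x erefl).
Definition rep {X : Type} (r : X -> X -> Prop) (P : quo r) : X :=
  projT1 (cid (projT2 P)).

(* An element satisfying [P]; [x0] when there is none. *)
Definition the {X : Type} (x0 : X) (P : set X) : X :=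
  @xget {classic X} x0 P.

Definition card_lt {T U : Type} (A : set T) (B : set U) : Prop :=
  (A #<= B) /\ ~ (B #<= A).

Definition strict_well_order {T : Type} (lt : T -> T -> Prop) (A : set T) :
    Prop :=
  [/\ forall x, A x -> ~ lt x x,
      forall x y z, A x -> A y -> A z -> lt x y -> lt y z -> lt x z
    & forall B : set T, B `<=` A -> B !=set0 ->
        exists2 x, B x & forall y, B y -> y = x \/ lt x y].

(* [level R n] is S_n.  By induction S_(n+1) = R u P(S_n), a disjoint union
   since reals are individuals; [lift_level] is the inclusion of S_n in S_(n+1),
   and the union of the S_n is their direct limit. *)
Fixpoint level (R : realType) (n : nat) : Type :=
  if n is m.+1 then (R + set (level R m))%type else R.

Fixpoint lift_level {R : realType} {n : nat} : level R n -> level R n.+1 :=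
  match n with
  | 0 => fun r => inl r
  | m.+1 => fun x => match x with
                     | inl r => inl r
                     | inr A => inr [set lift_level a | a in A]
                     end
  end.

Inductive lifts_to {R : realType} {n : nat} (x : level R n) :
    forall m, level R m -> Prop :=
| lifts_refl : lifts_to x x
| lifts_step m (y : level R m) : lifts_to x y -> lifts_to x (lift_level y).

Definition superstructure (R : realType) : Type :=
  quo (fun p q : {n & level R n} =>
    exists m (z : level R m), lifts_to (projT2 p) z /\ lifts_to (projT2 q) z).

Definition elt {R : realType} {n : nat} (x : level R n) : superstructure R :=
  cls _ (existT _ n x).

Definition mem_set_of {R : realType} {n : nat} (A : set (level R n)) :
  superstructure R := @elt R n.+1 (inr A).

Definition indiv {R : realType} (r : R) : superstructure R := @elt R 0 r.

Definition of_real {R : realType} (n : nat) : R -> level R n :=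
  match n with 0 => id | m.+1 => fun r => inl r end.

Definition reals (R : realType) : superstructure R :=
  mem_set_of (range (@of_real R 0)).

Definition mem_s {R : realType} (u v : superstructure R) : Prop :=
  exists n (x : level R n) (A : set (level R n)),
    [/\ u = elt x, v = mem_set_of A & A x].

Definition entity (R : realType) : Type :=
  {v : superstructure R | forall r : R, v <> indiv r}.

Definition kpair {R : realType} {n : nat} (x y : level R n) : level R n.+2 :=
  inr [set (inr [set x] : level R n.+1); inr [set x; y]].

(* The index of [formula] is the number of free variables (de Bruijn indices,
   0 being bound by the innermost quantifier); [C] is the type of the constants
   allowed in atomic formulas.  The other connectives and the existential
   quantifier are definable. *)
Inductive term (C : Type) (n : nat) : Type :=
| Var of 'I_n
| Cst of C.

Inductive formula (R : realType) (C : Type) : nat -> Type :=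
| Eq n : term C n -> term C n -> formula R C n
| In n : term C n -> term C n -> formula R C n
| Neg n : formula R C n -> formula R C n
| And n : formula R C n -> formula R C n -> formula R C n
| All n : entity R -> formula R C n.+1 -> formula R C n.

(* [star] interprets the constants naming the elements of the superstructure. *)
Record structure (R : realType) := Structure {
  carrier :> Type;
  eqE : carrier -> carrier -> Prop;
  memI : carrier -> carrier -> Prop;
  star : superstructure R -> carrier }.

Definition standard (R : realType) : structure R :=
  @Structure R (superstructure R) eq mem_s id.

Definition teval {A C : Type} (c : C -> A) {n : nat} (env : n.-tuple A)
    (t : term C n) : A :=
  match t with Var i => tnth env i | Cst a => c a end.

Fixpoint sat {R : realType} (M : structure R) {C : Type} (c : C -> M) {n : nat}
    (phi : formula R C n) : n.-tuple M -> Prop :=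
  match phi with
  | Eq _ t u => fun env => eqE (teval c env t) (teval c env u)
  | In _ t u => fun env => memI (teval c env t) (teval c env u)
  | Neg _ p => fun env => ~ sat c p env
  | And _ p q => fun env => sat c p env /\ sat c q env
  | All _ b p => fun env =>
      forall a : M, memI a (star M (sval b)) -> sat c p [tuple of a :: env]
  end.

Record model (R : realType) := Model {
  model_str :> structure R;
  star_inj : injective (star model_str);
  star_eq : forall u v, eqE (star model_str u) (star model_str v) <-> u = v;
  star_mem : forall u v,
    memI (star model_str u) (star model_str v) <-> mem_s u v;
  transfer : forall phi : formula R (superstructure R) 0,
    @sat R model_str _ (star model_str) 0 phi [tuple] <->
    @sat R (standard R) _ id 0 phi [tuple];
  (* *R is a proper extension of R *)
  star_proper : exists2 x : model_str,
    memI x (star model_str (reals R)) &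
    forall r : R, ~ eqE x (star model_str (indiv r)) }.

Record elementary_extension {R : realType} (M N : model R) := ElemExt {
  emb :> M -> N;
  emb_inj : injective emb;
  emb_star : forall u, emb (star M u) = star N u;
  emb_elem : forall phi : formula R M 0,
    @sat R M M id 0 phi [tuple] -> @sat R N M emb 0 phi [tuple] }.

(* The nonstandard extension of the entity {x | x in A}; as "=" is interpreted
   by [eqE], its elements are classes of [eqE]. *)
Definition star_set {R : realType} (M : structure R) {n : nat}
    (A : set (level R n)) : Type :=
  quo (fun x y : {x : M | memI x (star M (mem_set_of A))} =>
    eqE (sval x) (sval y)).

Definition srep {R : realType} {M : structure R} {n : nat}
  {A : set (level R n)} (x : star_set M A) : M := sval (rep x).

Definition star_level {R : realType} (M : structure R) (n : nat) : set M :=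
  [set x | memI x (star M (mem_set_of (setT : set (level R n))))].

Arguments star_level {R} M n _.

(* The interpretation in M of the bounded formula "p is the Kuratowski pair
   (x, y)" for x, y in S_n. *)
Definition is_pair {R : realType} {M : structure R} (n : nat) (p x y : M) :
    Prop :=
  star_level M n.+2 p /\
  forall u, star_level M n.+1 u ->
    (memI u p <->
     (forall w, star_level M n w -> (memI w u <-> eqE w x)) \/
     (forall w, star_level M n w -> (memI w u <-> eqE w x \/ eqE w y))).

Definition hreal {R : realType} (M : structure R) : Type :=
  star_set M (range (@of_real R 0)).

Lemma real_mem {R : realType} (M : model R) (r : R) :
  memI (star M (indiv r)) (star M (reals R)).
Proof. by apply/star_mem; exists 0%N, r, (range (@of_real R 0)); split => //; exists r. Qed.

Definition hstd {R : realType} {M : model R} (r : R) : hreal M :=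
  cls _ (exist _ (star M (indiv r)) (real_mem M r)).

(* The graph of f : X -> R (resp. X -> X -> R), where [code] identifies X with a
   subset of S_n; the nonstandard extension of f is the function whose graph is
   the image of this entity under [star]. *)
Definition graph1 {R : realType} {X : Type} {n : nat} (code : X -> level R n)
    (f : X -> R) : superstructure R :=
  mem_set_of [set kpair (code x) (of_real n (f x)) | x in setT].

Definition graph2 {R : realType} {X : Type} {n : nat} (code : X -> level R n)
    (f : X -> X -> R) : superstructure R :=
  mem_set_of [set kpair (kpair (code xy.1) (code xy.2))
                        (of_real n.+2 (f xy.1 xy.2)) | xy in setT].

Definition ext1 {R : realType} {M : model R} {X : Type} {n : nat}
    (code : X -> level R n) (f : X -> R) (x : star_set M (range code)) :
    hreal M :=
  the (hstd 0) [set z | exists2 q : M,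
    is_pair n q (srep x) (srep z) & memI q (star M (graph1 code f))].

Definition ext2 {R : realType} {M : model R} {X : Type} {n : nat}
    (code : X -> level R n) (f : X -> X -> R) (x y : star_set M (range code)) :
    hreal M :=
  the (hstd 0) [set z | exists p q : M,
    [/\ is_pair n p (srep x) (srep y), is_pair n.+2 q p (srep z)
      & memI q (star M (graph2 code f))]].

Definition hlt {R : realType} {M : model R} (x y : hreal M) : Prop :=
  exists2 p : M, is_pair 0 p (srep x) (srep y) &
    memI p (star M (mem_set_of
      [set kpair (ab.1 : level R 0) ab.2 | ab in [set ab : R * R | ab.1 < ab.2]])).

Definition hopp {R : realType} {M : model R} : hreal M -> hreal M :=
  ext1 (fun r : R => - r).
Definition habs {R : realType} {M : model R} : hreal M -> hreal M :=
  ext1 (fun r : R => `|r|).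
Definition hinv {R : realType} {M : model R} : hreal M -> hreal M :=
  ext1 (fun r : R => r^-1).
Definition hlog {R : realType} {M : model R} : hreal M -> hreal M :=
  ext1 (fun r : R => ln r).
Definition hadd {R : realType} {M : model R} : hreal M -> hreal M -> hreal M :=
  ext2 (fun r s : R => r + s).
Definition hmul {R : realType} {M : model R} : hreal M -> hreal M -> hreal M :=
  ext2 (fun r s : R => r * s).

Definition infinitesimal {R : realType} {M : model R} (x : hreal M) : Prop :=
  forall e : R, 0 < e -> hlt (habs x) (hstd e).

Definition hfinite {R : realType} {M : model R} (x : hreal M) : Prop :=
  exists K : R, hlt (habs x) (hstd K).

Definition st {R : realType} {M : model R} (x : hreal M) : R :=
  the 0 [set r | infinitesimal (hadd x (hopp (hstd r)))].

Lemma emb_real {R : realType} (M N : model R) (j : elementary_extension M N)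
    (x : M) :
  memI x (star M (reals R)) -> memI (j x) (star N (reals R)).
Proof.
move=> xR; rewrite -(emb_star j).
exact: (emb_elem j (phi := In R (Cst 0 x) (Cst 0 (star M (reals R)))) xR).
Qed.

(* The inclusion of *R_M in *R_N. *)
Definition hemb {R : realType} {M N : model R} (j : elementary_extension M N)
    (x : hreal M) : hreal N :=
  cls _ (exist _ (j (srep x)) (emb_real j (svalP (rep x)))).

Definition cosh {R : realType} (t : R) : R := (expR t + expR (- t)) / 2.
Definition sinh {R : realType} (t : R) : R := (expR t - expR (- t)) / 2.

(* The circle R/2piZ is represented by its fundamental domain. *)
Definition in_circle {R : realType} (t : R) : Prop := 0 <= t < 2 * pi.

(* All the polar coordinates (0, phi) describe the origin; (0, 0) is kept. *)
Record plane (R : realType) := Plane {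
  rho : R;
  phi : R;
  rho_ge0 : 0 <= rho;
  phi_circle : in_circle phi;
  phi_origin : rho = 0 -> phi = 0 }.

Definition dist_plane {R : realType} (x y : plane R) : R :=
  the 0 [set t | 0 <= t /\
    cosh t = cosh (rho x) * cosh (rho y)
             - sinh (rho x) * sinh (rho y) * cos (phi x - phi y)].

Definition code_plane {R : realType} (x : plane R) : level R 2 :=
  kpair (rho x : level R 0) (phi x : level R 0).

Definition star_plane {R : realType} (M : model R) : Type :=
  star_set M (range (@code_plane R)).

Definition star_rho {R : realType} {M : model R} : star_plane M -> hreal M :=
  ext1 (@rho R).

Definition star_dist {R : realType} {M : model R} :
    star_plane M -> star_plane M -> hreal M :=
  ext2 (@dist_plane R).

Definition asympt_pre {R : realType} {M : model R} (eps : hreal M) : Type :=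
  {x : star_plane M | hfinite (hmul eps (star_rho x))}.

Definition asympt_near {R : realType} {M : model R} (eps : hreal M)
    (x y : asympt_pre eps) : Prop :=
  infinitesimal (hmul eps (star_dist (sval x) (sval y))).

Definition asymptotic_space {R : realType} {M : model R} (eps : hreal M) :
  Type := quo (@asympt_near R M eps).

Definition asympt_dist {R : realType} {M : model R} {eps : hreal M}
    (x y : asymptotic_space eps) : R :=
  st (hmul eps (star_dist (sval (rep x)) (sval (rep y)))).

(* [prec] is a strict well-order on *R whose order type is the least ordinal of
   cardinality |*R|, i.e. each of whose initial segments has a cardinality less
   than |*R|. *)
Definition initial_well_order {R : realType} {M : model R}
    (prec : hreal M -> hreal M -> Prop) : Prop :=
  strict_well_order prec setT /\
  forall x, card_lt [set y | prec y x] [set: hreal M].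

Definition hnonzero {R : realType} (M : model R) : Type :=
  {x : hreal M | x <> hstd 0}.

Definition same_magnitude {R : realType} {M : model R} (x y : hnonzero M) :
    Prop :=
  hfinite (hmul (sval x) (hinv (sval y))) /\
  hfinite (hmul (sval y) (hinv (sval x))).

Definition Lambda {R : realType} (M : model R) : Type :=
  quo (@same_magnitude R M).

Definition lam {R : realType} {M : model R} : hnonzero M -> Lambda M := cls _.

Definition lam_lt {R : realType} {M : model R} (l m : Lambda M) : Prop :=
  l <> m /\ exists x y : hnonzero M,
    [/\ l = lam x, m = lam y & hlt (habs (sval x)) (habs (sval y))].

Definition lam_le {R : realType} {M : model R} (l m : Lambda M) : Prop :=
  l = m \/ lam_lt l m.

Lemma lifts_of_real {R : realType} (r : R) m (z : level R m) :
  @lifts_to R 0 r m z -> z = of_real m r.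
Proof. by elim=> // -[|k] y _ ->. Qed.

Lemma indiv_inj {R : realType} : injective (@indiv R).
Proof.
move=> r s /(congr1 (fun u => sval u (existT _ 0%N s))) /= e.
have : exists m (z : level R m),
    @lifts_to R 0 s m z /\ @lifts_to R 0 s m z.
  by exists 0%N, s; split; constructor.
rewrite -e => -[m [z [/lifts_of_real -> /lifts_of_real]]].
by case: m {z} => [|m] //= [].
Qed.

Lemma hstd1_neq0 {R : realType} (M : model R) : (hstd 1 : hreal M) <> hstd 0.
Proof.
move=> h; have : eqE (star M (indiv (0 : R))) (star M (indiv 1)).
  have := congr1 (fun u : hreal M => sval u
    (exist (fun x => memI x (star M (reals R))) _ (real_mem M 1))) h.
  by rewrite /= => <-; apply/star_eq.
by move=> /star_eq /indiv_inj /esym /eqP; rewrite oner_eq0.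
Qed.

Definition hone {R : realType} (M : model R) : hnonzero M :=
  exist _ (hstd 1) (@hstd1_neq0 R M).

Definition lam0 {R : realType} {M : model R} : Lambda M := lam (hone M).

(* a_lambda, where [prec] is the chosen well-ordering of *R. *)
Definition lam_choice {R : realType} {M : model R}
    (prec : hreal M -> hreal M -> Prop) (l : Lambda M) : hnonzero M :=
  if pselect (l = lam0) then hone M else
  the (hone M) [set x | lam x = l /\
    forall y : hnonzero M, lam y = l -> y <> x -> prec (sval x) (sval y)].

(* Meant for lambda <= lambda^0, where - eps log|a_lambda| is nonnegative or
   infinitesimal, so that +oo is its standard part when it is infinite. *)
Definition lam_g {R : realType} {M : model R} (eps : hreal M)
    (prec : hreal M -> hreal M -> Prop) (l : Lambda M) : \bar R :=
  let x := hopp (hmul eps (hlog (habs (sval (lam_choice prec l))))) in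
  if pselect (hfinite x) then (st x)%:E else +oo%E.

(* A pair (f, lambda_1).  [fn] is a partial function with domain
   {lambda | lambda_1 <= lambda <= lambda^0}, undefined elsewhere. *)
Record Fpair (R : realType) (M : model R) (eps : hreal M)
    (prec : hreal M -> hreal M -> Prop) := FPair {
  low : Lambda M;
  low_le : lam_le low lam0;
  low_fin : (lam_g eps prec low < +oo)%E;
  fn : Lambda M -> option R;
  fn_dom : forall l, fn l <> None <-> lam_le low l /\ lam_le l lam0;
  fn_circle : forall t, fn lam0 = Some t -> in_circle t;
  fn_supp : exists S : set (Lambda M),
    [/\ strict_well_order (fun l m => lam_lt m l) S,
        card_lt S [set: hreal M]
      & forall l t, fn l = Some t -> ~ S l -> t = 0] }.

Definition F_agree {R : realType} {M : model R} {eps : hreal M}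
    {prec : hreal M -> hreal M -> Prop} (p q : Fpair eps prec)
    (l : Lambda M) : Prop :=
  exists t, fn p l = Some t /\ fn q l = Some t.

Definition F_sup {R : realType} {M : model R} {eps : hreal M}
    {prec : hreal M -> hreal M -> Prop} (p q : Fpair eps prec) : R :=
  sup [set h : R | forall l, lam_le l lam0 -> (lam_g eps prec l < h%:E)%E ->
                             F_agree p q l].

Definition F_delta {R : realType} {M : model R} {eps : hreal M}
    {prec : hreal M -> hreal M -> Prop} (p q : Fpair eps prec) : R :=
  (fine (lam_g eps prec (low p)) - F_sup p q) +
  (fine (lam_g eps prec (low q)) - F_sup p q).

Definition F_space {R : realType} {M : model R} (eps : hreal M)
    (prec : hreal M -> hreal M -> Prop) : Type :=
  quo (fun p q : Fpair eps prec => F_delta p q = 0).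

Definition F_dist {R : realType} {M : model R} {eps : hreal M}
    {prec : hreal M -> hreal M -> Prop} (x y : F_space eps prec) : R :=
  F_delta (rep x) (rep y).

(* Main.v *)
Require Import Defs.
From Stdlib Require Eqdep_dec PeanoNat.
From mathcomp Require Import all_boot all_order all_algebra.
From mathcomp Require Import all_classical all_reals all_analysis.
From mathcomp Require Import ring lra.

(** M' is an ultrapower of M whose index set consists of the finite sequences J
of elements of Lambda, the ultrafilter containing { J | l in J } for every l.
A pair (f, lambda_1) is sent to the family, indexed by J, of the points of polar
coordinates
  rho = - log |a_{lambda_1}|,   phi = sum_{l in J} f(l) a_l,
computed in M.  If l is the largest class where two pairs differ (or lambda_1,
when one of the functions extends the other), then, as soon as l is in J, the
difference of the angles is of the order of a_l (at most of this order,
respectively), hence the distance d of the two points satisfies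
  d = rho_1 + rho_2 - 2 (- log |a_l|) + O(1),
because cosh d = cos^2(D/2) cosh(rho_1 - rho_2) + sin^2(D/2) cosh(rho_1 + rho_2)
when D is the difference of the angles.  Multiplying by epsilon gives
g(lambda_1) + g(lambda_2) - 2 g(l), which is delta.

Nonstandard computations are reduced to standard ones as follows.  An internal
element p of the star of W = P(R) defines an ultrafilter on W (the sets A whose
star contains p), and each F : W -> X has a value at p.  By transfer, the
operations of *R act on values pointwise, and relations between values are the
pointwise relations that hold almost everywhere.  Since W x W embeds in W,
finitely many hyperreals are always values at a common p. *)

Set Implicit Arguments.
Unset Strict Implicit.
Unset Printing Implicit Defensive.
(* [eqE] is otherwise that of eqtype. *)
Import Defs.
Import Order.TTheory GRing.Theory Num.Theory.
Import numFieldNormedType.Exports.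
Local Open Scope classical_set_scope.
Local Open Scope ring_scope.

(** * Superstructures *)

(** The expansion of an angle along a whole support has no meaning among the hyperreals of M: a
    support may be infinite and no convergence is available. Finite truncations do make sense, and
    finitely many terms of lower class are together still negligible against [a_l]; this is why the
    index set consists of truncations. Comparing two given pairs involves only three classes, the
    two ends and the branching class, which almost every index contains, so one ultrafilter serves
    all pairs at once. Well-ordered supports guarantee that a largest class of disagreement exists.
    Two features of the encoding shape the lemmas. Equality is interpreted by [eqE], so hyperreals
    are classes with chosen representatives, and relations pass to classes only after their
    invariance has itself been transferred. Formulas are syntactic objects with de Bruijn variables;
    to transfer ordinary statements, a predicate is given on all structures simultaneously and is
    [definable] when a single formula expresses it in each of them. *)

Section Superstructure.
Variable R : realType.
Implicit Types (n m : nat) (u v : superstructure R).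

Lemma inr_level n (A B : set (level R n)) :
  A = B -> (inr A : level R n.+1) = inr B.
Proof. by move->. Qed.

Lemma lift_level_inj n : injective (@lift_level R n).
Proof.
elim: n => [|n IH]; first by move=> x y [].
move=> [x|A] [y|B] //= [] E; first by rewrite E. 
  apply: inr_level; apply/seteqP; split=> a Aa.
- have : [set lift_level a | a in B] (lift_level a) by rewrite -E; exists a.
  by move=> [b Bb /IH <-].
- have : [set lift_level a | a in A] (lift_level a) by rewrite E; exists a.
  by move=> [b Bb /IH <-].
Qed.

Fixpoint lift_iter n (x : level R n) k : level R (k + n) :=
  if k is k'.+1 then lift_level (lift_iter x k') else x.

Lemma lift_iter_inj n k : injective (fun x : level R n => lift_iter x k).
Proof. by elim: k => [|k IH] // x y /= /lift_level_inj /IH. Qed.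

(** The levels [m] and [k + n] are equal only propositionally, hence the comparison as dependent
    pairs; decidable equality on [nat] later recovers the second components. *)
Lemma lifts_to_iter n m (x : level R n) (z : level R m) : lifts_to x z ->
  exists k, existT (level R) m z = existT (level R) (k + n)%N (lift_iter x k).
Proof.
elim=> [|m' y _ [k E]]; first by exists 0%N.
exists k.+1; pose up (q : {n & level R n}) :=
  existT (level R) (projT1 q).+1 (lift_level (projT2 q)).
by have := congr1 up E.
Qed.

Lemma lifts_to_inj n m (x y : level R n) (z : level R m) :
  lifts_to x z -> lifts_to y z -> x = y.
Proof.
move=> /lifts_to_iter [k Ek] /lifts_to_iter [k' E]; rewrite {}Ek in E.
have kk' : k = k' by have /= /addIn := congr1 (@projT1 _ _) E.
rewrite -{}kk' in E; apply: (@lift_iter_inj _ k).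
exact: (Eqdep_dec.inj_pair2_eq_dec _ PeanoNat.Nat.eq_dec _ _ _ _ E).
Qed.

Definition common_lift (p q : {n & level R n}) : Prop :=
  exists m (z : level R m), lifts_to (projT2 p) z /\ lifts_to (projT2 q) z.

(** A class is a predicate; evaluating the equality of classes at [y] reduces the claim to
    reflexivity. *)
Lemma elt_common n m (x : level R n) (y : level R m) :
  elt x = elt y -> common_lift (existT _ n x) (existT _ m y).
Proof.
move=> /(congr1 (fun u : superstructure R => sval u (existT _ m y))) /= E.
have : common_lift (existT _ m y) (existT _ m y).
  by exists m, y; split; constructor.
by rewrite /common_lift -E.
Qed.

Lemma elt_inj n : injective (@elt R n).
Proof. by move=> x y /elt_common [m [z [/lifts_to_inj h /h]]]. Qed.

Lemma lifts_to_lift n m (x : level R n) (z : level R m) :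
  lifts_to x z -> lifts_to (lift_level x) (lift_level z).
Proof. by elim=> [|k y _ h]; constructor. Qed.

Lemma lifts_from_lift n m (x : level R n) (z : level R m) :
  lifts_to (lift_level x) z -> lifts_to x z.
Proof. by elim=> [|k y _ h]; repeat constructor. Qed.

Lemma elt_lift n (x : level R n) : elt (lift_level x) = elt x.
Proof.
apply: eq_exist => /=; apply/funext => q; apply/propext; split.
- by move=> [m [z [/= /lifts_from_lift h hq]]]; exists m, z.
- move=> [m [z [/= h hq]]]; exists m.+1, (lift_level z).
  by split=> /=; [exact: lifts_to_lift|constructor].
Qed.

(** Membership read off one representative. Its invariance under lifting replaces the existential
    over levels in [mem_s] by a computation. *)
Definition is_member (q : {n & level R n}) u : Prop :=
  match q with
  | existT n x =>
    match n return level R n -> Prop with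
    | 0 => fun _ => False
    | m.+1 => fun x =>
      if x is inr A then exists2 a : level R m, A a & u = elt a else False
    end x
  end.

Lemma is_member_lift n (x : level R n) u :
  is_member (existT _ n.+1 (lift_level x)) u <-> is_member (existT _ n x) u.
Proof.
case: n x => [|n] // [r|A] //=; split.
- by move=> [_ [a Aa <-] ->]; exists a; rewrite ?elt_lift.
- by move=> [a Aa ->]; exists (lift_level a); rewrite ?elt_lift //; exists a.
Qed.

Lemma is_member_lifts n m (x : level R n) (z : level R m) u :
  lifts_to x z -> is_member (existT _ m z) u <-> is_member (existT _ n x) u.
Proof. by elim=> // k y _ IH; rewrite is_member_lift. Qed.

Lemma mem_s_elt n (x : level R n) u :
  mem_s u (elt x) <-> is_member (existT _ n x) u.
Proof.
split.
- move=> [m [y [A [-> /elt_common [k [z [hx hA]]] Ay]]]].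
  apply/(is_member_lifts _ hx)/(is_member_lifts _ hA) => /=.
  by exists y.
- case: n x => [|n] // [r|A] //= [a Aa ->].
  by exists n, a, A.
Qed.

Lemma mem_s_setE n (A : set (level R n)) u :
  mem_s u (mem_set_of A) <-> exists2 a, A a & u = elt a.
Proof. by rewrite /mem_set_of mem_s_elt. Qed.

Lemma mem_s_set n (A : set (level R n)) (x : level R n) :
  mem_s (elt x) (mem_set_of A) <-> A x.
Proof.
rewrite mem_s_setE; split=> [[a Aa /elt_inj ->]//|Ax]; by exists x.
Qed.

Definition is_set_level (q : {n & level R n}) : Prop :=
  match q with
  | existT n x =>
    match n return level R n -> Prop with
    | 0 => fun _ => False
    | m.+1 => fun x => if x is inr _ then True else False
    end x
  end.

(** Lifting keeps a set a set and a real a real, so they have no common lift. *)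
Lemma mem_set_of_entity n (A : set (level R n)) r : mem_set_of A <> indiv r.
Proof.
move=> /elt_common [m [z [/= hA /lifts_of_real zr]]].
have : is_set_level (existT _ m z).
  by elim: hA {zr} => // k y _; case: k y => [|k] // [].
by rewrite zr; case: (m).
Qed.

Definition entity_of n (A : set (level R n)) : entity R :=
  exist _ (mem_set_of A) (@mem_set_of_entity n A).

Lemma elt_of_real n (r : R) : elt (of_real n r) = indiv r.
Proof.
elim: n => // n IH; rewrite -IH -(elt_lift (of_real n r)).
by case: n {IH}.
Qed.

Lemma kpair_inj n (x y x' y' : level R n) :
  kpair x y = kpair x' y' -> x = x' /\ y = y'.
Proof.
move=> [] E.
have inr_eq (A B : set (level R n)) : (inr A : level R n.+1) = inr B -> A = B.
  by case.
have xx' : x = x'.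
  have : [set (inr [set x'] : level R n.+1); inr [set x'; y']] (inr [set x]).
    by rewrite -E; left.
  move=> [] /inr_eq h; first by have : [set x'] x by rewrite -h.
  by have : [set x] x' by rewrite h; left.
subst x'; split=> //.
have : [set (inr [set x] : level R n.+1); inr [set x; y']] (inr [set x; y]).
  by rewrite -E; right.
have : [set (inr [set x] : level R n.+1); inr [set x; y]] (inr [set x; y']).
  by rewrite E; right.
have y'in : [set x; y'] y' by right.
have yin : [set x; y] y by right.
move=> [] /inr_eq h1 [] /inr_eq h2.
- by move: y'in yin; rewrite h1 h2 => -> ->.
- by move: y'in yin; rewrite h2 h1 => -> ->.
- by move: y'in yin; rewrite h1 h2 => -> ->.
- move: y'in; rewrite h1 => -[e|-> //].
  by move: yin; rewrite -h1 e => -[->|->].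
Qed.

Lemma star_level_standard n (v : standard R) :
  star_level (standard R) n v <-> exists x : level R n, v = elt x.
Proof.
rewrite /star_level /= mem_s_setE.
by split=> [[x _ ->]|[x ->]]; exists x.
Qed.

(** Each quantifier of [is_pair] ranges over one level, which contains all possible members of the
    sets concerned, so extensionality applies. A real in the place of a set is excluded: it has no
    members, while [a], respectively [{a}], has to be one. *)
Lemma is_pair_standard n (p : standard R) (a b : level R n) :
  @is_pair R (standard R) n p (elt a) (elt b) <-> p = elt (kpair a b).
Proof.
have ext (V : set (level R n)) (B : set (level R n)) :
    (forall w : standard R, star_level (standard R) n w ->
       (mem_s w (elt (inr V : level R n.+1)) <-> exists2 c, B c & w = elt c)) <->
    V = B.
  split=> [h|-> w _]; last exact: mem_s_setE.
  apply/seteqP; split=> x hx.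
  - have /h : star_level (standard R) n (elt x : standard R).
      by apply/star_level_standard; exists x.
    by move=> [/(_ ((mem_s_set V x).2 hx)) [c Bc /elt_inj ->]].
  - have /h : star_level (standard R) n (elt x : standard R).
      by apply/star_level_standard; exists x.
    by move=> [_ /(_ (ex_intro2 _ _ x hx erefl)) /mem_s_set].
have e1 (w : superstructure R) : (exists2 c, [set a] c & w = elt c) <-> w = elt a.
  by split=> [[c -> //]|->]; exists a.
have e2 (w : superstructure R) :
    (exists2 c, [set a; b] c & w = elt c) <-> w = elt a \/ w = elt b.
  split=> [[c [->|->] ->]|[->|->]]; [by left|by right| |].
    by exists a => //; left.
  by exists b => //; right.
have spec (u : level R n.+1) :
    ((forall w : standard R, star_level (standard R) n w -> (mem_s w (elt u) <-> w = elt a)) \/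
     (forall w : standard R, star_level (standard R) n w ->
        (mem_s w (elt u) <-> w = elt a \/ w = elt b))) <->
    [set (inr [set a] : level R n.+1); inr [set a; b]] u.
  case: u => [r|V].
    have la : star_level (standard R) n (elt a : standard R).
      by apply/star_level_standard; exists a.
    split; last by case.
    by case=> /(_ _ la) /=; rewrite mem_s_elt /= => -[_ h]; elim: h => //; left.
  split.
  - case=> h; [left|right]; apply: inr_level; apply/ext => w lw; rewrite h //.
      by rewrite e1.
    by rewrite e2.
  - case=> -[/ext h]; [left|right] => w lw; rewrite h //.
split.
- case=> /star_level_standard [P ->] h; congr elt.
  have {}h (u : level R n.+1) : mem_s (elt u) (elt P) <->
      [set (inr [set a] : level R n.+1); inr [set a; b]] u.
    rewrite -spec -h //.
    by apply/star_level_standard; exists u.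
  case: P h => [r|P] h.
    have /h : [set (inr [set a] : level R n.+1); inr [set a; b]] (inr [set a]).
      by left.
    by rewrite mem_s_elt.
  by apply: inr_level; apply/seteqP; split=> x /=; rewrite -mem_s_set h.
- move=> ->; split; first by apply/star_level_standard; exists (kpair a b).
  move=> u /star_level_standard [x ->] /=.
  by rewrite spec mem_s_set.
Qed.

End Superstructure.

(** * Definability and transfer *)

Section Definability.
Variable R : realType.

Definition defterm n (t : forall S : structure R, n.-tuple S -> S) : Prop :=
  exists u : term (superstructure R) n,
    forall S env, teval (star S) env u = t S env.

(** Uniformity in the structure lets a fact checked in the standard structure be moved to M, and a
    relation in an ultrapower be read coordinatewise. *)
Definition definable n (P : forall S : structure R, n.-tuple S -> Prop) : Prop :=
  exists phi : formula R (superstructure R) n,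
    forall S env, sat (star S) phi env <-> P S env.

Lemma defterm_head n : @defterm n.+1 (fun S env => thead env).
Proof. by exists (Var _ ord0). Qed.

Lemma defterm_behead n t : @defterm n t ->
  @defterm n.+1 (fun S env => t S (behead_tuple env)).
Proof.
case=> -[i|c] h; last by exists (Cst _ c) => S env; rewrite -h.
exists (Var _ (lift ord0 i)) => S env; rewrite -h /=.
by rewrite !(tnth_nth (thead env)) /= nth_behead.
Qed.

Lemma defterm_var1 n : @defterm n.+2 (fun S env => thead (behead_tuple env)).
Proof. exact: (defterm_behead (@defterm_head _)). Qed.

Lemma defterm_var2 n :
  @defterm n.+3 (fun S env => thead (behead_tuple (behead_tuple env))).
Proof. exact: (defterm_behead (@defterm_var1 _)). Qed.

Lemma defterm_var3 n : @defterm n.+4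
  (fun S env => thead (behead_tuple (behead_tuple (behead_tuple env)))).
Proof. exact: (defterm_behead (@defterm_var2 _)). Qed.

Lemma defterm_var4 n : @defterm n.+4.+1 (fun S env =>
  thead (behead_tuple (behead_tuple (behead_tuple (behead_tuple env))))).
Proof. exact: (defterm_behead (@defterm_var3 _)). Qed.

Lemma defterm_var5 n : @defterm n.+4.+2 (fun S env => thead (behead_tuple
  (behead_tuple (behead_tuple (behead_tuple (behead_tuple env)))))).
Proof. exact: (defterm_behead (@defterm_var4 _)). Qed.

Lemma defterm_star n u : @defterm n (fun S env => star S u).
Proof. by exists (Cst _ u). Qed.

Lemma def_eq n t u : defterm t -> defterm u ->
  @definable n (fun S env => eqE (t S env) (u S env)).
Proof. by move=> [a ha] [b hb]; exists (Eq _ a b) => S env /=; rewrite ha hb. Qed.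

Lemma def_mem n t u : defterm t -> defterm u ->
  @definable n (fun S env => memI (t S env) (u S env)).
Proof. by move=> [a ha] [b hb]; exists (In _ a b) => S env /=; rewrite ha hb. Qed.

Lemma def_not n P : definable P -> @definable n (fun S env => ~ P S env).
Proof. by move=> [f hf]; exists (Neg f) => S env /=; rewrite hf. Qed.

Lemma def_and n P Q : definable P -> definable Q ->
  @definable n (fun S env => P S env /\ Q S env).
Proof. by move=> [f hf] [g hg]; exists (And f g) => S env /=; rewrite hf hg. Qed.

Lemma def_ext n P Q : @definable n P -> (forall S env, P S env <-> Q S env) ->
  @definable n Q.
Proof. by move=> [f hf] h; exists f => S env; rewrite hf. Qed.

Lemma def_imp n P Q : definable P -> definable Q ->
  @definable n (fun S env => P S env -> Q S env).
Proof.
move=> dP dQ; apply: (def_ext (def_not (def_and dP (def_not dQ)))) => S env.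
by split=> [h p|h [p nq]]; [apply: contrapT => q; apply: h | apply/nq/h].
Qed.

Lemma def_or n P Q : definable P -> definable Q ->
  @definable n (fun S env => P S env \/ Q S env).
Proof.
move=> dP dQ; apply: (def_ext (def_imp (def_not dP) dQ)) => S env.
split=> [h|[p|q] //].
by case: (pselect (P S env)) => [p|/h]; [left|right].
Qed.

Lemma def_iff n P Q : definable P -> definable Q ->
  @definable n (fun S env => P S env <-> Q S env).
Proof. by move=> dP dQ; apply: def_and; apply: def_imp. Qed.

Lemma def_all n k (A : set (level R k)) P :
  definable (fun S env => P S (behead_tuple env) (thead env)) ->
  @definable n (fun S env => forall a : S,
    memI a (star S (mem_set_of A)) -> P S env a).
Proof.
move=> [f hf]; exists (All (entity_of A) f) => S env /=.
have he a : behead_tuple [tuple of a :: env] = env by apply: val_inj.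
by split=> h a /h; rewrite hf he theadE.
Qed.

Lemma def_ex n k (A : set (level R k)) P :
  definable (fun S env => P S (behead_tuple env) (thead env)) ->
  @definable n (fun S env => exists2 a : S,
    memI a (star S (mem_set_of A)) & P S env a).
Proof.
move=> dP; apply: (def_ext (def_not (@def_all n k A (fun S env a => ~ P S env a)
  (def_not dP)))) => S env.
split=> [h|[a Aa Pa] h]; last exact: (h a).
by apply: contrapT => h'; apply: h => a Aa Pa; apply: h'; exists a.
Qed.

Lemma def_is_pair n k t u v : defterm t -> defterm u -> defterm v ->
  @definable n (fun S env => is_pair k (t S env) (u S env) (v S env)).
Proof.
move=> dt du dv; rewrite /is_pair /star_level /mkset.
apply: def_and; first by apply: def_mem => //; exact: defterm_star.
apply: def_all; apply: def_iff.
  by apply: def_mem; [exact: defterm_head|exact: defterm_behead].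
have d1 u' : defterm u' ->
    @definable n.+2 (fun S env => eqE (thead env)
      (u' S (behead_tuple (behead_tuple env)))).
  move=> du'; apply: def_eq; first exact: defterm_head.
  exact: (defterm_behead (defterm_behead du')).
have d2 : @definable n.+2 (fun S env =>
      memI (thead env) (thead (behead_tuple env))).
  apply: def_mem; first exact: defterm_head.
  exact: (defterm_behead (@defterm_head _)).
apply: def_or; apply: def_all; apply: def_iff => //.
- exact: d1.
- by apply: def_or; apply: d1.
Qed.

Lemma transfer_def (M : model R) (P : structure R -> Prop) :
  @definable 0 (fun S _ => P S) -> P (standard R) -> P M.
Proof. by move=> [f hf] /(hf _ [tuple]) h; apply/(hf _ [tuple])/transfer. Qed.

End Definability.

(** * Evaluation, graphs and order as definable predicates *)

Section Relations.
Variable R : realType.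

Definition scode (w : set R) : level R 1 := inr w.

Lemma scode_inj : injective scode.
Proof. by move=> v w []. Qed.

(** Kuratowski pairs need both components at the same level: [w], of level 1, is lifted [n] times to
    be paired with the lift of a code of level [n]. *)
Fixpoint scode_at n (w : set R) : level R n.+1 :=
  match n with 0 => scode w | m.+1 => lift_level (scode_at m w) end.

Lemma elt_scode_at n w : elt (scode_at n w) = elt (scode w).
Proof. by elim: n => // n IH; rewrite elt_lift. Qed.

Definition large_at (S : structure R) (p : S) (A : set (set R)) : Prop :=
  memI p (star S (mem_set_of [set scode w | w in A])).

Definition is_value (S : structure R) (X : Type) n (code : X -> level R n)
    (F : set R -> X) (p y : S) : Prop :=
  exists2 q : S, is_pair n.+1 q p y & memI q (star S (mem_set_of
    [set kpair (scode_at n w) (lift_level (code (F w))) | w in setT])).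

(** [rel1], [rel2] and [rel_lt] repeat the conditions behind [ext1], [ext2] and [hlt] for elements
    of the structure instead of classes, since formulas speak of elements. *)
Definition rel1 (S : structure R) (X : Type) n (code : X -> level R n)
    (f : X -> R) (y z : S) : Prop :=
  exists2 q : S, is_pair n q y z & memI q (star S (graph1 code f)).

Definition rel2 (S : structure R) (X : Type) n (code : X -> level R n)
    (f : X -> X -> R) (x y z : S) : Prop :=
  exists p q : S, [/\ is_pair n p x y, is_pair n.+2 q p z
      & memI q (star S (graph2 code f))].

Definition rel_lt (S : structure R) (x y : S) : Prop :=
  exists2 p : S, is_pair 0 p x y &
    memI p (star S (mem_set_of
      [set kpair (ab.1 : level R 0) ab.2 | ab in [set ab : R * R | ab.1 < ab.2]])).

(** The existential over [q] is unbounded as written; it becomes bounded because [is_pair] forces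
    [q] into a level. *)
Lemma def_pair_in n k t u (A : set (level R k.+2)) : defterm t -> defterm u ->
  @definable R n (fun S env => exists2 q : S, is_pair k q (t S env) (u S env) &
    memI q (star S (mem_set_of A))).
Proof.
move=> dt du; apply: (@def_ext _ _ (fun S env => exists2 q : S,
  memI q (star S (mem_set_of [set: level R k.+2])) & is_pair k q (t S env) (u S env) /\
    memI q (star S (mem_set_of A)))).
  apply: def_ex; apply: def_and.
    by apply: def_is_pair; [exact: defterm_head|exact: defterm_behead..].
  by apply: def_mem; [exact: defterm_head|exact: defterm_star].
move=> S env; split=> [[q _ [h1 h2]]|[q h1 h2]]; exists q => //.
by case: h1.
Qed.

Lemma def_is_value n X k (code : X -> level R k) F t u :
  defterm t -> defterm u ->
  @definable R n (fun S env => is_value code F (t S env) (u S env)).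
Proof. exact: def_pair_in. Qed.

Lemma def_rel1 n X k (code : X -> level R k) f t u :
  defterm t -> defterm u ->
  @definable R n (fun S env => rel1 code f (t S env) (u S env)).
Proof. exact: def_pair_in. Qed.

Lemma def_rel_lt n t u : defterm t -> defterm u ->
  @definable R n (fun S env => rel_lt (t S env) (u S env)).
Proof. exact: def_pair_in. Qed.

Lemma def_rel2 n X k (code : X -> level R k) f t u v :
  defterm t -> defterm u -> defterm v ->
  @definable R n (fun S env => rel2 code f (t S env) (u S env) (v S env)).
Proof.
move=> dt du dv; rewrite /rel2 /graph2; set A := (X in mem_set_of X).
apply: (@def_ext _ _ (fun S env => exists2 p : S,
  memI p (star S (mem_set_of [set: level R k.+2])) & is_pair k p (t S env) (u S env) /\
   exists2 q : S, is_pair k.+2 q p (v S env) & memI q (star S (mem_set_of A)))).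
  apply: def_ex; apply: def_and.
    by apply: def_is_pair; [exact: defterm_head|exact: defterm_behead..].
  by apply: def_pair_in; [exact: defterm_head|exact: defterm_behead..].
move=> S env; split=> [[p _ [h [q h1 h2]]]|[p [q [h1 h2 h3]]]].
  by exists p, q.
by exists p; [case: h1|split=> //; exists q].
Qed.

Lemma large_at_standard w A :
  large_at (elt (scode w) : standard R) A <-> A w.
Proof.
rewrite /large_at /= mem_s_set; split=> [[v Av /scode_inj <-] //|Aw].
by exists w.
Qed.

Lemma range_standard X n (code : X -> level R n) (v : standard R) :
  memI v (star (standard R) (mem_set_of (range code))) <->
  exists x, v = elt (code x).
Proof.
rewrite /= mem_s_setE; split=> [[_ [x _ <-] ->]|[x ->]]; first by exists x.
by exists (code x) => //; exists x.
Qed.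

Lemma pair_in_standard n (a b : level R n) (A : set (level R n.+2)) :
  (exists2 q : standard R, is_pair n q (elt a : standard R) (elt b) &
    memI q (star (standard R) (mem_set_of A))) <-> A (kpair a b).
Proof.
split=> [[q /is_pair_standard -> /mem_s_set//]|h].
by exists (elt (kpair a b)); [exact/is_pair_standard|exact/mem_s_set].
Qed.

Lemma is_value_standard X n (code : X -> level R n) F w x :
  injective code ->
  is_value code F (elt (scode w) : standard R) (elt (code x)) <-> x = F w.
Proof.
move=> ic; rewrite /is_value -(elt_scode_at n w) -(elt_lift (code x)).
rewrite pair_in_standard; split=> [[v _ /kpair_inj [e1]]|->]; last by exists w.
move=> /lift_level_inj /ic <-; congr F; apply: scode_inj; apply: elt_inj.
by rewrite -(elt_scode_at n v) e1 elt_scode_at.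
Qed.

Lemma of_real_inj n : injective (@of_real R n).
Proof. by move=> r s /(congr1 elt); rewrite !elt_of_real => /elt_inj. Qed.

Lemma rel1_standard X n (code : X -> level R n) f x r : injective code ->
  rel1 code f (elt (code x) : standard R) (indiv r) <-> r = f x.
Proof.
move=> ic; rewrite /rel1 -(elt_of_real n r) /graph1 pair_in_standard.
split=> [[v _ /kpair_inj [/ic -> /of_real_inj]] //|->].
by exists x.
Qed.

Lemma rel2_standard X n (code : X -> level R n) f x y r : injective code ->
  rel2 code f (elt (code x) : standard R) (elt (code y)) (indiv r) <-> r = f x y.
Proof.
move=> ic; split=> [[p [q [/is_pair_standard ->]]]|->].
  rewrite -(elt_of_real n.+2 r) => /is_pair_standard -> /mem_s_set.
  move=> [[a b] _] /kpair_inj [/kpair_inj [/ic e1 /ic e2] /of_real_inj <-].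
  by rewrite -e1 -e2.
exists (elt (kpair (code x) (code y))).
exists (elt (kpair (kpair (code x) (code y)) (of_real n.+2 (f x y)))).
split; first exact/is_pair_standard.
  by rewrite -(elt_of_real n.+2); exact/is_pair_standard.
by apply/mem_s_set; exists (x, y).
Qed.

Lemma rel_lt_standard (r s : R) :
  rel_lt (indiv r : standard R) (indiv s) <-> r < s.
Proof.
rewrite /rel_lt pair_in_standard; split=> [[[a b] /= ab /(@kpair_inj R 0) [<- <-]]//|h].
by exists (r, s).
Qed.

End Relations.

Arguments large_at {R S} p A.

Ltac definability :=
  repeat first
    [ apply: defterm_head | apply: defterm_star
    | apply: defterm_var1 | apply: defterm_var2 | apply: defterm_var3
    | apply: defterm_var4 | apply: defterm_var5
    | apply: def_is_value | apply: def_rel1 | apply: def_rel2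
    | apply: def_rel_lt | apply: def_eq | apply: def_mem | apply: def_all
    | apply: def_ex | apply: def_iff | apply: def_and | apply: def_or
    | apply: def_not | apply: def_imp ].

(** * Laws of evaluation at an internal point, obtained by transfer *)

Section Calculus.
Variables (R : realType) (M : model R).
Implicit Types (p : M) (A B : set (set R)).

Local Notation "x \in* A" := (memI x (star _ (mem_set_of A))) (at level 70).
Local Notation W := (range (@scode R)).

Lemma large_atI A B p : p \in* W ->
  large_at p A -> large_at p B -> large_at p (A `&` B).
Proof.
move: p; apply: (@transfer_def _ M (fun S => forall p : S, p \in* W ->
  large_at p A -> large_at p B -> large_at p (A `&` B))).
  by definability.
by move=> _ /range_standard [w ->]; rewrite !large_at_standard.
Qed.

Lemma large_atS A B p : p \in* W ->
  A `<=` B -> large_at p A -> large_at p B.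
Proof.
move=> + AB; move: p; apply: (@transfer_def _ M (fun S => forall p : S, p \in* W ->
  large_at p A -> large_at p B)).
  by definability.
by move=> _ /range_standard [w ->]; rewrite !large_at_standard; apply: AB.
Qed.

Lemma large_atVC A p : p \in* W -> large_at p A \/ large_at p (~` A).
Proof.
move: p; apply: (@transfer_def _ M (fun S => forall p : S, p \in* W ->
  large_at p A \/ large_at p (~` A))).
  by definability.
by move=> _ /range_standard [w ->]; rewrite !large_at_standard; exact: EM.
Qed.

Lemma large_at0 p : p \in* W -> ~ large_at p set0.
Proof.
move: p; apply: (@transfer_def _ M (fun S => forall p : S, p \in* W ->
  ~ large_at p set0)).
  by definability.
by move=> _ /range_standard [w ->]; rewrite !large_at_standard.
Qed.

Section Coded.
Variables (X : Type) (n : nat) (code : X -> level R n).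
Hypothesis ic : injective code.
Implicit Types (y z : M).

Lemma is_value_ex F p : p \in* W ->
  exists2 y : M, y \in* range code & is_value code F p y.
Proof.
move: p; apply: (@transfer_def _ M (fun S => forall p : S, p \in* W ->
  exists2 y : S, y \in* range code & is_value code F p y)).
  by definability.
move=> _ /range_standard [w ->]; exists (elt (code (F w))).
  by apply/range_standard; exists (F w).
exact/is_value_standard.
Qed.

Lemma is_value_eq F G p : p \in* W -> forall y, y \in* range code ->
  forall z, z \in* range code ->
  is_value code F p y -> is_value code G p z ->
  eqE y z <-> large_at p [set w | F w = G w].
Proof.
move: p; apply: (@transfer_def _ M (fun S => forall p : S, p \in* W ->
  forall y : S, y \in* range code -> forall z : S, z \in* range code ->
  is_value code F p y -> is_value code G p z ->
  (eqE y z <-> large_at p [set w | F w = G w]))).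
  by definability.
move=> _ /range_standard [w ->] _ /range_standard [x ->] _ /range_standard [y ->].
rewrite !is_value_standard // large_at_standard => -> -> /=.
by split=> [/elt_inj/ic|->].
Qed.

Lemma is_value_eqE F p : p \in* W -> forall y, y \in* range code ->
  forall z, z \in* range code -> eqE y z ->
  is_value code F p y -> is_value code F p z.
Proof.
move: p; apply: (@transfer_def _ M (fun S => forall p : S, p \in* W ->
  forall y : S, y \in* range code -> forall z : S, z \in* range code ->
  eqE y z -> is_value code F p y -> is_value code F p z)).
  by definability.
move=> _ /range_standard [w ->] _ /range_standard [x ->] _ /range_standard [y ->].
by move=> /= /elt_inj/ic ->.
Qed.

Lemma is_value_cover (s : set R -> X) : (forall x, exists w, s w = x) ->
  forall y, y \in* range code -> exists2 p : M, p \in* W & is_value code s p y.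
Proof.
move=> sX; apply: (@transfer_def _ M (fun S => forall y : S, y \in* range code ->
  exists2 p : S, p \in* W & is_value code s p y)).
  by definability.
move=> _ /range_standard [x ->]; have [w swx] := sX x.
exists (elt (scode w)); first by apply/range_standard; exists w.
exact/is_value_standard.
Qed.

Lemma is_value_comp F (f : set R -> set R) p : p \in* W ->
  forall q, q \in* W -> is_value (@scode R) f p q ->
  forall y, y \in* range code ->
  is_value code F q y -> is_value code (F \o f) p y.
Proof.
move: p; apply: (@transfer_def _ M (fun S => forall p : S, p \in* W ->
  forall q : S, q \in* W -> is_value (@scode R) f p q ->
  forall y : S, y \in* range code ->
  is_value code F q y -> is_value code (F \o f) p y)).
  by definability.
move=> _ /range_standard [w ->] _ /range_standard [v ->].
rewrite is_value_standard; last exact: scode_inj.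
by move=> -> _ /range_standard [y ->]; rewrite !is_value_standard.
Qed.

Lemma is_value_rel1 F (f : X -> R) p : p \in* W ->
  forall y, y \in* range code -> forall z, z \in* range (@of_real R 0) ->
  is_value code F p y ->
  rel1 code f y z <-> is_value (@of_real R 0) (f \o F) p z.
Proof.
move: p; apply: (@transfer_def _ M (fun S => forall p : S, p \in* W ->
  forall y : S, y \in* range code -> forall z : S, z \in* range (@of_real R 0) ->
  is_value code F p y ->
  (rel1 code f y z <-> is_value (@of_real R 0) (f \o F) p z))).
  by definability.
move=> _ /range_standard [w ->] _ /range_standard [x ->] _ /range_standard [r ->].
by rewrite !is_value_standard // => ->; rewrite elt_of_real rel1_standard.
Qed.

Lemma is_value_rel2 F G (f : X -> X -> R) p : p \in* W ->
  forall x, x \in* range code -> forall y, y \in* range code ->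
  forall z, z \in* range (@of_real R 0) ->
  is_value code F p x -> is_value code G p y ->
  rel2 code f x y z <-> is_value (@of_real R 0) (fun w => f (F w) (G w)) p z.
Proof.
move: p; apply: (@transfer_def _ M (fun S => forall p : S, p \in* W ->
  forall x : S, x \in* range code -> forall y : S, y \in* range code ->
  forall z : S, z \in* range (@of_real R 0) ->
  is_value code F p x -> is_value code G p y ->
  (rel2 code f x y z <-> is_value (@of_real R 0) (fun w => f (F w) (G w)) p z))).
  by definability.
move=> _ /range_standard [w ->] _ /range_standard [x ->] _ /range_standard [y ->].
move=> _ /range_standard [r ->].
by rewrite !is_value_standard // => -> ->; rewrite elt_of_real rel2_standard.
Qed.

End Coded.

Lemma is_value_lt F G p : p \in* W ->
  forall y, y \in* range (@of_real R 0) -> forall z, z \in* range (@of_real R 0) ->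
  is_value (@of_real R 0) F p y -> is_value (@of_real R 0) G p z ->
  rel_lt y z <-> large_at p [set w | F w < G w].
Proof.
move: p; apply: (@transfer_def _ M (fun S => forall p : S, p \in* W ->
  forall y : S, y \in* range (@of_real R 0) ->
  forall z : S, z \in* range (@of_real R 0) ->
  is_value (@of_real R 0) F p y -> is_value (@of_real R 0) G p z ->
  (rel_lt y z <-> large_at p [set w | F w < G w]))).
  by definability.
move=> _ /range_standard [w ->] _ /range_standard [x ->] _ /range_standard [y ->].
by rewrite !is_value_standard // => -> ->; rewrite rel_lt_standard large_at_standard.
Qed.

Lemma is_value_const (r : R) p : p \in* W ->
  is_value (@of_real R 0) (fun=> r) p (star M (indiv r)).
Proof.
move: p; apply: (@transfer_def _ M (fun S => forall p : S, p \in* W ->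
  is_value (@of_real R 0) (fun=> r) p (star S (indiv r)))).
  by definability.
by move=> _ /range_standard [w ->]; apply/is_value_standard.
Qed.

Lemma is_value_merge (f g : set R -> set R) :
  (forall v w, exists2 u, f u = v & g u = w) ->
  forall p, p \in* W -> forall q, q \in* W ->
  exists2 r : M, r \in* W &
    is_value (@scode R) f r p /\ is_value (@scode R) g r q.
Proof.
move=> fg; apply: (@transfer_def _ M (fun S => forall p : S, p \in* W ->
  forall q : S, q \in* W -> exists2 r : S, r \in* W &
    is_value (@scode R) f r p /\ is_value (@scode R) g r q)).
  by definability.
move=> _ /range_standard [v ->] _ /range_standard [w ->].
have [u fu gu] := fg v w; exists (elt (scode u)).
  by apply/range_standard; exists u.
by split; apply/is_value_standard => //; exact: scode_inj.
Qed.

End Calculus.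

(** * Values of standard functions *)

Lemma the_unique (X : Type) (x0 x : X) (P : set X) :
  P x -> (forall y, P y -> y = x) -> the x0 P = x.
Proof. exact: (@xget_unique {classic X}). Qed.

Lemma theP (X : Type) (x0 : X) (P : set X) : (exists x, P x) -> P (the x0 P).
Proof. by move=> [x Px]; apply: (@xgetPex {classic X}); exists x. Qed.

Lemma repP (X : Type) (r : X -> X -> Prop) (P : quo r) : cls r (rep P) = P.
Proof.
case: P => P hP; apply: eq_exist; rewrite /rep.
by case: (cid _) => x /= ->.
Qed.

Section Values.
Variables (R : realType) (M : model R).

Local Notation "x \in* A" := (memI x (star _ (mem_set_of A))) (at level 70).

Record spoint := SPoint {
  point_val :> M;
  point_in : point_val \in* (range (@scode R)) }.

Implicit Types (p : spoint).

Definition gen p : set_system (set R) := large_at (point_val p).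

Global Instance gen_filter p : ProperFilter (gen p).
Proof.
split; first exact: large_at0 (point_in p).
split; first exact: point_in.
- by move=> A B; exact: large_atI (point_in p).
- by move=> A B; exact: large_atS (point_in p).
Qed.

Global Instance gen_ultra p : UltraFilter (gen p).
Proof.
split; first exact: gen_filter.
move=> G GF pG; apply/seteqP; split=> // A GA.
have [//|/pG GAC] := large_atVC A (point_in p).
by case: (@filter_not_empty _ G GF); rewrite -(setICr A); apply: filterI.
Qed.

Lemma eqE_refl k (A : set (level R k)) (x : M) : x \in* A -> eqE x x.
Proof.
move: x; apply: (@transfer_def _ M (fun S => forall x : S, x \in* A -> eqE x x)).
  by definability.
by [].
Qed.

(** Transfer reaches bounded statements only, so [eqE] is handled as an equivalence inside a
    standard bounding set, never globally. *)
Lemma eqE_left k (A : set (level R k)) (x : M) : x \in* A ->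
  forall y, y \in* A -> forall z, z \in* A -> eqE x y -> (eqE x z <-> eqE y z).
Proof.
move: x; apply: (@transfer_def _ M (fun S => forall x : S, x \in* A ->
  forall y : S, y \in* A -> forall z : S, z \in* A ->
  eqE x y -> (eqE x z <-> eqE y z))).
  by definability.
by move=> x _ y _ z _ /= ->.
Qed.

Section StarSet.
Variables (k : nat) (A : set (level R k)).

Definition star_cls (y : M) (yA : y \in* A) : star_set M A :=
  cls _ (exist (fun x => x \in* A) y yA).

Lemma srep_in (x : star_set M A) : srep x \in* A.
Proof. exact: (svalP (rep x)). Qed.

Lemma srep_cls y (yA : y \in* A) : eqE y (srep (star_cls yA)).
Proof.
have := repP (star_cls yA) => /(congr1 sval) /= /(congr1 (@^~ (rep (star_cls yA)))).
rewrite -[sval (rep _)]/(srep _) => <-.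
exact: eqE_refl (srep_in _).
Qed.

Lemma srep_inj (x y : star_set M A) : eqE (srep x) (srep y) -> x = y.
Proof.
move=> xy; rewrite -(repP x) -(repP y); apply: eq_exist.
apply/funext => z; apply/propext.
exact: (eqE_left (srep_in x) (srep_in y) (svalP z) xy).
Qed.

End StarSet.

Section Coded.
Variables (X : Type) (n : nat) (code : X -> level R n).
Hypothesis ic : injective code.
Local Notation SX := (star_set M (range code)).
Implicit Types (x y : SX) (F G : set R -> X).

Lemma is_value_exists p F : exists x : SX, is_value code F p (srep x).
Proof.
have [y yX yF] := is_value_ex ic F (point_in p); exists (star_cls yX).
by apply: (is_value_eqE ic (point_in p) yX (srep_in _)) => //; exact: srep_cls.
Qed.

Definition value p F : SX := projT1 (cid (is_value_exists p F)).

Lemma valueP p F : is_value code F p (srep (value p F)).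
Proof. exact: projT2 (cid (is_value_exists p F)). Qed.

Lemma value_eq p F G : value p F = value p G <-> \forall w \near gen p, F w = G w.
Proof.
have h := is_value_eq ic (point_in p) (srep_in _) (srep_in _)
  (valueP p F) (valueP p G).
split=> [e|/h/srep_inj //]; apply/h; rewrite e.
exact: eqE_refl (srep_in _).
Qed.

Lemma value_uniq p F x : is_value code F p (srep x) <-> x = value p F.
Proof.
split=> [h|->]; last exact: valueP.
apply: srep_inj.
apply/(is_value_eq ic (point_in p) (srep_in _) (srep_in _) h (valueP p F)).
exact: filterE.
Qed.

Lemma value_cover (s : set R -> X) : (forall x : X, exists w, s w = x) ->
  forall x, exists p, x = value p s.
Proof.
move=> sX x; have [q qW qx] := is_value_cover ic sX (srep_in x).
by exists (SPoint qW); apply/value_uniq.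
Qed.

End Coded.

Arguments value {X n code} ic p F.

Lemma value_merge p q : exists r (f g : set R -> set R),
  (forall X n (code : X -> level R n) (ic : injective code) F,
     value ic p F = value ic r (F \o f)) /\
  (forall X n (code : X -> level R n) (ic : injective code) F,
     value ic q F = value ic r (F \o g)).
Proof.
(* A set of reals is split into its positive and its negative part, each read through [expR]. Any
   two sets arise from a single one: the exponentials of the first together with the opposites of
   the exponentials of the second. *)
pose f (u : set R) := [set x | u (expR x)]; pose g (u : set R) := [set x | u (- expR x)].
have fg v w : exists2 u, f u = v & g u = w.
  exists ([set expR x | x in v] `|` [set - expR x | x in w]).
    apply/seteqP; split=> x /=.
      move=> [[y vy /expR_inj <- //]|[y wy e]].
      by have := expR_gt0 x; rewrite -e oppr_gt0 ltNge expR_ge0.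
    by move=> vx; left; exists x.
  apply/seteqP; split=> x /=.
    move=> [[y vy e]|[y wy /oppr_inj/expR_inj <- //]].
    by have := expR_gt0 y; rewrite e oppr_gt0 ltNge expR_ge0.
  by move=> vx; right; exists x.
have [r rW [rp rq]] := is_value_merge fg (point_in p) (point_in q).
exists (SPoint rW), f, g; split=> X n code ic F; apply/value_uniq.
- exact (is_value_comp ic (point_in (SPoint rW)) (point_in p) rp (srep_in _) (valueP ic p F)).
- exact (is_value_comp ic (point_in (SPoint rW)) (point_in q) rq (srep_in _) (valueP ic q F)).
Qed.

Lemma real_code_inj : injective (@of_real R 0).
Proof. by []. Qed.

Definition hval p (F : set R -> R) : hreal M := value real_code_inj p F.

Lemma rel1_value X n (code : X -> level R n) (ic : injective code) p
    (F : set R -> X) (f : X -> R) (z : hreal M) :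
  rel1 code f (srep (value ic p F)) (srep z) <-> z = hval p (f \o F).
Proof.
rewrite (is_value_rel1 ic f (point_in p) (srep_in _) (srep_in _) (valueP _ _ _)).
exact: value_uniq.
Qed.

Lemma rel2_value X n (code : X -> level R n) (ic : injective code) p
    (F G : set R -> X) (f : X -> X -> R) (z : hreal M) :
  rel2 code f (srep (value ic p F)) (srep (value ic p G)) (srep z) <->
  z = hval p (fun w => f (F w) (G w)).
Proof.
rewrite (is_value_rel2 ic f (point_in p) (srep_in _) (srep_in _) (srep_in _)
  (valueP _ _ _) (valueP _ _ _)).
exact: value_uniq.
Qed.

Lemma ext1_value X n (code : X -> level R n) (ic : injective code) p
    (F : set R -> X) (f : X -> R) :
  ext1 f (value ic p F) = hval p (f \o F).
Proof. by apply: the_unique => [|z]; rewrite /= -/(rel1 _ _ _ _) rel1_value. Qed.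

Lemma ext2_value X n (code : X -> level R n) (ic : injective code) p
    (F G : set R -> X) (f : X -> X -> R) :
  ext2 f (value ic p F) (value ic p G) = hval p (fun w => f (F w) (G w)).
Proof. by apply: the_unique => [|z]; rewrite /= -/(rel2 _ _ _ _ _) rel2_value. Qed.

Lemma hlt_hval p F G :
  hlt (hval p F) (hval p G) <-> \forall w \near gen p, F w < G w.
Proof.
exact (is_value_lt (point_in p) (srep_in (hval p F)) (srep_in (hval p G))
  (valueP real_code_inj p F) (valueP real_code_inj p G)).
Qed.

Lemma hstd_hval p (r : R) : hstd r = hval p (fun=> r).
Proof.
apply/value_uniq; apply: (is_value_eqE real_code_inj (point_in p) _ (srep_in _)).
- exact: real_mem.
- exact: srep_cls.
- exact: is_value_const (point_in p).
Qed.

Definition covers (X : Type) (s : set R -> X) := forall x : X, exists w, s w = x.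

Lemma real_covers : covers (the (0 : R)).
Proof. by move=> r; exists [set r]; apply: the_unique. Qed.

(** The graph relates each argument to exactly one class, so the choice made in [ext1] is
    characterised by the graph. The surjection [s] serves to write the argument as a value at an
    internal point. *)
Lemma ext1P X n (code : X -> level R n) (ic : injective code) (s : set R -> X) (sX : covers s)
    (f : X -> R) (x : star_set M (range code)) (z : hreal M) :
  rel1 code f (srep x) (srep z) <-> z = ext1 f x.
Proof.
by have [p ->] := value_cover ic sX x; rewrite rel1_value ext1_value.
Qed.

Lemma ext2P X n (code : X -> level R n) (ic : injective code) (s : set R -> X) (sX : covers s)
    (f : X -> X -> R) (x y : star_set M (range code)) (z : hreal M) :
  rel2 code f (srep x) (srep y) (srep z) <-> z = ext2 f x y.
Proof.
have [p ->] := value_cover ic sX x; have [q ->] := value_cover ic sX y.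
have [r [g [h [-> ->]]]] := value_merge p q.
by rewrite rel2_value ext2_value.
Qed.

Lemma rel1_eqE X n (code : X -> level R n) f (y : M) : y \in* range code ->
  forall y', y' \in* range code -> forall z, z \in* range (@of_real R 0) ->
  forall z', z' \in* range (@of_real R 0) ->
  eqE y y' -> eqE z z' -> rel1 code f y z -> rel1 code f y' z'.
Proof.
move: y; apply: (@transfer_def _ M (fun S => forall y : S, y \in* range code ->
  forall y' : S, y' \in* range code -> forall z : S, z \in* range (@of_real R 0) ->
  forall z' : S, z' \in* range (@of_real R 0) ->
  eqE y y' -> eqE z z' -> rel1 code f y z -> rel1 code f y' z')).
  by definability.
by move=> x _ y _ z _ t _ /= -> ->.
Qed.

Lemma rel2_eqE X n (code : X -> level R n) f (x : M) : x \in* range code ->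
  forall x', x' \in* range code -> forall y, y \in* range code ->
  forall y', y' \in* range code -> forall z, z \in* range (@of_real R 0) ->
  forall z', z' \in* range (@of_real R 0) ->
  eqE x x' -> eqE y y' -> eqE z z' -> rel2 code f x y z -> rel2 code f x' y' z'.
Proof.
move: x; apply: (@transfer_def _ M (fun S => forall x : S, x \in* range code ->
  forall x' : S, x' \in* range code -> forall y : S, y \in* range code ->
  forall y' : S, y' \in* range code -> forall z : S, z \in* range (@of_real R 0) ->
  forall z' : S, z' \in* range (@of_real R 0) ->
  eqE x x' -> eqE y y' -> eqE z z' -> rel2 code f x y z -> rel2 code f x' y' z')).
  by definability.
by move=> x _ x' _ y _ y' _ z _ z' _ /= -> -> ->.
Qed.

Lemma rel_lt_eqE (y : M) : y \in* range (@of_real R 0) ->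
  forall y', y' \in* range (@of_real R 0) ->
  forall z, z \in* range (@of_real R 0) ->
  forall z', z' \in* range (@of_real R 0) ->
  eqE y y' -> eqE z z' -> rel_lt y z -> rel_lt y' z'.
Proof.
move: y; apply: (@transfer_def _ M (fun S =>
  forall y : S, y \in* range (@of_real R 0) ->
  forall y' : S, y' \in* range (@of_real R 0) ->
  forall z : S, z \in* range (@of_real R 0) ->
  forall z' : S, z' \in* range (@of_real R 0) ->
  eqE y y' -> eqE z z' -> rel_lt y z -> rel_lt y' z')).
  by definability.
by move=> x _ y _ z _ t _ /= -> ->.
Qed.

Lemma hval_cover (x : hreal M) : exists p F, x = hval p F.
Proof.
by have [p ->] := value_cover real_code_inj real_covers x; exists p; eexists.
Qed.

Lemma hval_eq p F G : hval p F = hval p G <-> \forall w \near gen p, F w = G w.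
Proof. exact: value_eq. Qed.

Lemma hoppE p F : hopp (hval p F) = hval p (fun w => - F w).
Proof. exact: ext1_value. Qed.

Lemma habsE p F : habs (hval p F) = hval p (fun w => `|F w|).
Proof. exact: ext1_value. Qed.

Lemma hinvE p F : hinv (hval p F) = hval p (fun w => (F w)^-1).
Proof. exact: ext1_value. Qed.

Lemma hlogE p F : hlog (hval p F) = hval p (fun w => ln (F w)).
Proof. exact: ext1_value. Qed.

Lemma haddE p F G : hadd (hval p F) (hval p G) = hval p (fun w => F w + G w).
Proof. exact: ext2_value. Qed.

Lemma hmulE p F G : hmul (hval p F) (hval p G) = hval p (fun w => F w * G w).
Proof. exact: ext2_value. Qed.

Definition hvalE := (hoppE, habsE, hinvE, hlogE, haddE, hmulE).

Lemma infinitesimal_hval p F : infinitesimal (hval p F) <->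
  forall e, 0 < e -> \forall w \near gen p, `|F w| < e.
Proof.
rewrite /infinitesimal habsE.
by split=> h e /h; rewrite (hstd_hval p) hlt_hval.
Qed.

Lemma hfinite_hval p F : hfinite (hval p F) <->
  exists K, \forall w \near gen p, `|F w| < K.
Proof.
rewrite /hfinite habsE.
by split=> -[K h]; exists K; move: h; rewrite (hstd_hval p) hlt_hval.
Qed.

Definition hclose p (F : set R -> R) (r : R) : Prop :=
  forall e, 0 < e -> \forall w \near gen p, `|F w - r| < e.

Lemma close_hval p F r :
  infinitesimal (hadd (hval p F) (hopp (hstd r))) <-> hclose p F r.
Proof. by rewrite (hstd_hval p) !hvalE infinitesimal_hval. Qed.

Lemma close_uniq p F r s : hclose p F r -> hclose p F s -> r = s.
Proof.
move=> hr hs; apply/eqP; apply: contraT => rs.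
have e0 : 0 < `|r - s| / 2 by rewrite divr_gt0 // normr_gt0 subr_eq0.
have [w [h1 h2]] := filter_ex (filterI (hr _ e0) (hs _ e0)).
have : `|r - s| <= `|F w - r| + `|F w - s|.
  by rewrite distrC (_ : s - r = (F w - r) - (F w - s)) ?ler_normB//; ring.
by move: (`|r - s|) (`|F w - r|) (`|F w - s|) h1 h2 => a b c h1 h2 h3; lra.
Qed.

Lemma st_close p F r : hclose p F r -> st (hval p F) = r.
Proof.
move=> h; apply: the_unique => [|s]; rewrite /= close_hval //.
by move=> hs; apply: close_uniq hs h.
Qed.

(** Existence of standard parts: the real is the supremum of the reals that lie below [F] almost
    everywhere. *)
Lemma bounded_close p F K : (\forall w \near gen p, `|F w| < K) ->
  exists r, hclose p F r.
Proof.
move=> FK; pose A := [set x | \forall w \near gen p, x < F w].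
have A0 : A !=set0.
  by exists (- K); apply: filterS FK => w; rewrite ltr_norml => /andP[].
have ubA x : A x -> x <= K.
  move=> Ax; have [w [h1 h2]] := filter_ex (filterI Ax FK).
  by apply: ltW (lt_trans h1 _); apply: le_lt_trans h2; exact: ler_norm.
have supA : has_sup A by split=> //; exists K.
exists (sup A) => e e0.
have [x Ax hx] := sup_adherent e0 supA.
have h2 : \forall w \near gen p, F w <= sup A + e / 2.
  (* In the other case of the ultrafilter dichotomy [sup A + e / 2] would itself belong to [A]. *)
  have [h|] := in_ultra_setVsetC [set w | F w <= sup A + e / 2] (gen_ultra p) => //.
  move=> h; suff : sup A + e / 2 <= sup A by lra.
  apply: ub_le_sup; first by case: supA.
  by apply: filterS h => w /= /negP; rewrite -ltNge.
apply: filterS (filterI Ax h2) => w [/= h3 h4].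
by rewrite ltr_norml; apply/andP; split; lra.
Qed.

Lemma st_finite p F : hfinite (hval p F) -> hclose p F (st (hval p F)).
Proof.
by move=> /hfinite_hval [K /bounded_close [r h]]; rewrite (st_close h).
Qed.

End Values.

Arguments value {R M X n code} ic p F.

(** * Ultrapowers *)

Section Ultrapower.
Variables (R : realType) (M : model R) (I : Type) (U : set_system I).
Hypothesis UU : UltraFilter U.

(** Functions are not identified modulo the ultrafilter; the interpretation of equality does that.
    The star map and the embedding then take values in constant functions, and their injectivity is
    literal. *)
Definition ultrapower_str : structure R := @Structure R (I -> M)
  (fun x y => \forall i \near U, eqE (x i) (y i))
  (fun x y => \forall i \near U, memI (x i) (y i))
  (fun u _ => star M u).
Local Notation N := ultrapower_str.

Lemma near_cst (P : Prop) : (\forall i \near U, P) <-> P.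
Proof. by split=> [/filter_ex[]|p]; last exact: filterE. Qed.

Lemma near_not (P : I -> Prop) :
  (\forall i \near U, ~ P i) <-> ~ (\forall i \near U, P i).
Proof.
split=> [h1 h2|h]; last by case: (in_ultra_setVsetC [set i | P i] UU).
by have [i [p]] := filter_ex (filterI h2 h1); apply.
Qed.

Definition at_index n (env : n.-tuple N) (i : I) : n.-tuple M :=
  map_tuple (fun x : I -> M => x i) env.

Lemma teval_at C (c : C -> N) n (env : n.-tuple N) (t : term C n) i :
  teval c env t i = teval (c^~ i) (at_index env i) t.
Proof. by case: t => [j|a] //=; rewrite tnth_map. Qed.

Lemma Los C (c : C -> N) n (phi : formula R C n) (env : n.-tuple N) :
  sat c phi env <->
  \forall i \near U, sat (M := M) (c^~ i) phi (at_index env i).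
Proof.
elim: phi env => [{}n t u|{}n t u|{}n p IH|{}n p IHp q IHq|{}n b p IH] env /=.
- by under [X in _ <-> X]eq_near do rewrite -!teval_at.
- by under [X in _ <-> X]eq_near do rewrite -!teval_at.
- by rewrite IH near_not.
- rewrite IHp IHq; split=> [[h1 h2]|h]; first exact: filterI.
  by split; apply: filterS h => i [].
- have at_cons a i : at_index [tuple of a :: env] i
      = [tuple of a i :: at_index env i] by apply: val_inj.
  split=> [h|h a ab]; last first.
    apply/IH; apply: filterS (filterI h ab) => i [h1 h2].
    by rewrite at_cons; apply: h1.
  apply: contrapT => /near_not nh.
  (* An implication, so that [choice] applies at every index; where no counterexample exists, an
     arbitrary default is taken. *)
  have ch i : exists a : M, (~ forall a, memI a (star M (sval b)) ->
      sat (M := M) (c^~ i) p [tuple of a :: at_index env i]) ->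
    memI a (star M (sval b)) /\
    ~ sat (M := M) (c^~ i) p [tuple of a :: at_index env i].
    case: (pselect (exists a : M, memI a (star M (sval b)) /\
       ~ sat (M := M) (c^~ i) p [tuple of a :: at_index env i])).
      by move=> [a ha]; exists a.
    move=> ne; exists (star M (indiv 0)) => na; exfalso; apply: na => a ab.
    by apply: contrapT => hs; apply: ne; exists a.
  have [a ha] := choice ch.
  have ab : memI (a : N) (star N (sval b)) by apply: filterS nh => i /ha [].
  have /IH h' := h _ ab.
  have [i [h1 /ha [_]]] := filter_ex (filterI h' nh).
  by rewrite -at_cons.
Qed.

Lemma los_transfer (phi : formula R (superstructure R) 0) :
  @sat R N _ (star N) 0 phi [tuple] <->
  @sat R (standard R) _ id 0 phi [tuple].
Proof.
rewrite Los -(@transfer R M) -[X in _ <-> X]near_cst.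
by split; apply: filterS => i; rewrite (tuple0 (at_index _ i)).
Qed.

Lemma ultrapower_star_inj : injective (star N).
Proof.
have [i _] := filter_ex (filterT : U setT).
by move=> u v /(congr1 (@^~ i)) /= /star_inj.
Qed.

Lemma ultrapower_proper : exists2 x : N,
    memI x (star N (reals R)) & forall r : R, ~ eqE x (star N (indiv r)).
Proof.
have [x xR xr] := star_proper M; exists (fun=> x); first exact: filterE.
by move=> r h; apply: (xr r); apply/(near_cst (eqE x _)).
Qed.

Definition ultrapower : model R := @Model R N ultrapower_star_inj
  (fun u v => iff_trans (near_cst _) (star_eq _ u v))
  (fun u v => iff_trans (near_cst _) (star_mem _ u v))
  los_transfer ultrapower_proper.

Lemma ultrapower_emb_inj : injective ((fun x _ => x) : M -> ultrapower).
Proof.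
have [i _] := filter_ex (filterT : U setT).
by move=> x y /(congr1 (@^~ i)).
Qed.

Lemma ultrapower_emb_elem (phi : formula R M 0) :
  @sat R M M id 0 phi [tuple] ->
  @sat R ultrapower M (fun x _ => x) 0 phi [tuple].
Proof.
move=> h; apply/Los; apply: filterE => i.
by rewrite (tuple0 (at_index _ i)).
Qed.

Definition ultrapower_ext : elementary_extension M ultrapower :=
  @ElemExt R M ultrapower (fun x _ => x) ultrapower_emb_inj
    (fun u => erefl) ultrapower_emb_elem.

(** Los's theorem for predicates instead of formulas; it rests on one formula expressing [P] both in
    M and in the ultrapower. *)
Lemma definable_at n P (env : n.-tuple N) : @definable R n P ->
  (P N env <-> \forall i \near U, P M (at_index env i)).
Proof.
by move=> [phi h]; rewrite -h Los; split; apply: filterS => i /h.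
Qed.

Lemma rel1_at X n (code : X -> level R n) f (y z : N) :
  rel1 code f y z <-> \forall i \near U, rel1 code f (y i) (z i).
Proof.
apply: (definable_at (P := fun S env => rel1 code f (thead env)
  (thead (behead_tuple env))) [tuple y; z]).
by definability.
Qed.

Lemma rel_lt_at (y z : N) :
  rel_lt y z <-> \forall i \near U, rel_lt (y i) (z i).
Proof.
apply: (definable_at (P := fun S env => rel_lt (thead env)
  (thead (behead_tuple env))) [tuple y; z]).
by definability.
Qed.

Lemma rel2_at X n (code : X -> level R n) f (x y z : N) :
  rel2 code f x y z <-> \forall i \near U, rel2 code f (x i) (y i) (z i).
Proof.
apply: (definable_at (P := fun S env => rel2 code f (thead env)
  (thead (behead_tuple env)) (thead (behead_tuple (behead_tuple env))))
  [tuple x; y; z]).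
by definability.
Qed.

Section Lift.
Variables (k : nat) (A : set (level R k)).

Lemma family_in (x : I -> star_set M A) :
  memI ((fun i => srep (x i)) : ultrapower) (star ultrapower (mem_set_of A)).
Proof. by apply: filterE => i; exact: srep_in. Qed.

(** A family of classes of M yields a class of the ultrapower through representatives chosen index
    by index. The lemmas below let extensions of standard functions act on such families
    coordinatewise. *)
Definition family_cls (x : I -> star_set M A) : star_set ultrapower A :=
  star_cls (family_in x).

Lemma srep_family x : eqE ((fun i => srep (x i)) : ultrapower) (srep (family_cls x)).
Proof. exact: srep_cls. Qed.

End Lift.

Local Notation hfam x := (family_cls (A := range (@of_real R 0)) x).

Lemma ext1_family X n (code : X -> level R n) (ic : injective code)
    (s : set R -> X) (sX : covers s) f (x : I -> star_set M (range code)) :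
  ext1 f (family_cls x) = hfam (fun i => ext1 f (x i)).
Proof.
apply/esym; apply/(ext1P ic sX).
apply: (rel1_eqE (family_in _) (srep_in _) (family_in _) (srep_in _)
  (srep_family _) (srep_family _)).
by apply/rel1_at; apply: filterE => i; apply/(ext1P ic sX).
Qed.

Lemma ext2_family X n (code : X -> level R n) (ic : injective code)
    (s : set R -> X) (sX : covers s) f (x y : I -> star_set M (range code)) :
  ext2 f (family_cls x) (family_cls y) = hfam (fun i => ext2 f (x i) (y i)).
Proof.
apply/esym; apply/(ext2P ic sX).
apply: (rel2_eqE (family_in _) (srep_in _) (family_in _) (srep_in _)
  (family_in _) (srep_in _) (srep_family _) (srep_family _) (srep_family _)).
by apply/rel2_at; apply: filterE => i; apply/(ext2P ic sX).
Qed.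

Lemma hlt_family (x y : I -> hreal M) :
  (\forall i \near U, hlt (x i) (y i)) -> hlt (hfam x) (hfam y).
Proof.
move=> h; apply: (rel_lt_eqE (family_in _) (srep_in _) (family_in _) (srep_in _)
  (srep_family _) (srep_family _)).
exact/rel_lt_at.
Qed.

Lemma hstd_family (r : R) : hstd r = hfam (fun=> hstd r).
Proof.
apply: srep_inj.
have h := srep_family (fun=> hstd r : hreal M).
have h1 := srep_cls (real_mem ultrapower r).
have h2 : eqE (star ultrapower (indiv r)) ((fun=> srep (hstd r : hreal M)) : ultrapower).
  by apply: filterE => i; exact: srep_cls.
have h3 := (eqE_left (real_mem ultrapower r) (family_in _) (srep_in (hfam _)) h2).2 h.
exact: ((eqE_left (real_mem ultrapower r) (srep_in _) (srep_in (hfam _)) h1).1 h3).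
Qed.

Lemma hemb_family (x : hreal M) : hemb ultrapower_ext x = hfam (fun=> x).
Proof.
apply: srep_inj.
have h := srep_family (fun=> x).
have h1 := srep_cls (emb_real ultrapower_ext (svalP (rep x))).
exact: ((eqE_left (family_in _) (srep_in _) (srep_in (hfam _)) h1).1 h).
Qed.

End Ultrapower.

(** * Hyperbolic geometry *)

Section Hyperbolic.
Variable R : realType.
Implicit Types (s t u v : R).

Lemma coshD s t : cosh (s + t) = cosh s * cosh t + sinh s * sinh t.
Proof. by rewrite /cosh /sinh opprD !expRD; field. Qed.

Lemma coshN t : cosh (- t) = cosh t.
Proof. by rewrite /cosh opprK addrC. Qed.

Lemma sinhN t : sinh (- t) = - sinh t.
Proof. by rewrite /sinh opprK; field. Qed.

Lemma coshB s t : cosh (s - t) = cosh s * cosh t - sinh s * sinh t.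
Proof. by rewrite coshD coshN sinhN mulrN. Qed.

Lemma cosh0 : cosh 0 = 1 :> R.
Proof. by rewrite /cosh oppr0 expR0; field. Qed.

Lemma cosh2Bsinh2 t : cosh t ^+ 2 - sinh t ^+ 2 = 1.
Proof. by rewrite !expr2 -coshB subrr cosh0. Qed.

Lemma sinh_ge0 t : 0 <= t -> 0 <= sinh t.
Proof.
move=> t0; rewrite /sinh divr_ge0 // subr_ge0 ler_expR.
by lra.
Qed.

Lemma cosh_lt s t : 0 <= s -> s < t -> cosh s < cosh t.
Proof.
move=> s0 st; rewrite /cosh ltr_pM2r ?invr_gt0 // !expRN.
have es : 1 <= expR s by rewrite -expR0 ler_expR.
have et : expR s < expR t by rewrite ltr_expR.
move: (expR s) (expR t) es et => a b ha hb.
have a0 : 0 < a by lra.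
have b0 : 0 < b by lra.
rewrite -subr_gt0 (_ : _ - _ = (b - a) * (1 - (a * b)^-1)); last first.
  by field; rewrite !gt_eqF.
rewrite mulr_gt0 ?subr_gt0 // invf_lt1 ?mulr_gt0 //.
by nra.
Qed.

Lemma cosh_le s t : 0 <= t -> cosh s <= cosh t -> s <= t.
Proof. by move=> t0; apply: contraTT; rewrite -!ltNge; apply: cosh_lt. Qed.

Lemma cosh_ge1 t : 1 <= cosh t.
Proof.
rewrite -cosh0; have [t0|t0] := leP 0 t.
  by move: t0; rewrite le_eqVlt => /predU1P[<- //|/cosh_lt h]; apply/ltW/h.
by rewrite -(coshN t); apply/ltW/cosh_lt; rewrite ?oppr_gt0.
Qed.

Lemma cosh_surj v : 1 <= v -> exists2 t, 0 <= t & cosh t = v.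
Proof.
move=> v1; pose q := Num.sqrt (v ^+ 2 - 1).
have q0 : 0 <= q by exact: sqrtr_ge0.
have q2 : q ^+ 2 = v ^+ 2 - 1 by rewrite sqr_sqrtr // subr_ge0 expr_ge1 //; lra.
exists (ln (v + q)); first by apply: ln_ge0; lra.
have h : 0 < v + q by lra.
rewrite /cosh expRN lnK ?posrE // (_ : (v + q)^-1 = v - q); first by field.
apply: (mulfI (lt0r_neq0 h)); rewrite mulfV ?lt0r_neq0 //.
by rewrite mulrC -subr_sqr q2; ring.
Qed.

Lemma expR_cosh t : expR t / 2 <= cosh t.
Proof. by rewrite /cosh ler_pM2r // lerDl expR_ge0. Qed.

Lemma cosh_expR t u : t <= u -> - t <= u -> cosh t <= expR u.
Proof.
rewrite -[t <= u]ler_expR -[- t <= u]ler_expR => h1 h2.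
by rewrite /cosh ler_pdivrMr // mulrDr mulr1 lerD.
Qed.

(* The nonnegative quantity is the Gram determinant of three points of the
   hyperboloid model with pairwise inner products a, b and c. *)
Lemma cosh_triangle (a b c : R) : 1 <= a -> 1 <= b ->
  0 <= 1 + 2 * a * b * c - a ^+ 2 - b ^+ 2 - c ^+ 2 ->
  forall s t, 0 <= s -> 0 <= t -> cosh s = a -> cosh t = b ->
  c <= cosh (s + t).
Proof.
move=> a1 b1 gram s t s0 t0 es et; rewrite coshD es et.
have hs := cosh2Bsinh2 s; have ht := cosh2Bsinh2 t; rewrite es et in hs ht.
have ss := sinh_ge0 s0; have st := sinh_ge0 t0.
have [h|h] := leP (c - a * b) 0; first by have := mulr_ge0 ss st; lra.
move: (sinh s) (sinh t) hs ht ss st => x y hs ht x0 y0.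
rewrite -lerBlDl.
have xy0 : 0 <= x * y by exact: mulr_ge0.
rewrite -(@ler_pXn2r _ 2) ?nnegrE ?(ltW h) //.
rewrite exprMn -subr_ge0.
have -> : x ^+ 2 = a ^+ 2 - 1 by lra.
have -> : y ^+ 2 = b ^+ 2 - 1 by lra.
rewrite (_ : _ - _ = 1 + 2 * a * b * c - a ^+ 2 - b ^+ 2 - c ^+ 2) //.
by ring.
Qed.

Definition cosh_form r s d : R := cosh r * cosh s - sinh r * sinh s * cos d.

Lemma cosh_form_half r s d : cosh_form r s d =
  cos (d / 2) ^+ 2 * cosh (r - s) + sin (d / 2) ^+ 2 * cosh (r + s).
Proof.
rewrite /cosh_form coshB coshD.
have -> : cos d = cos (d / 2) ^+ 2 - sin (d / 2) ^+ 2.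
  by rewrite -[in LHS](divfK (_ : 2 != 0) d) // mulr_natr mulr2n cosD !expr2.
have := cos2Dsin2 (d / 2).
move: (cos _) (sin _) => x y h.
rewrite -[X in X - _ = _]mul1r -h; by ring.
Qed.

Lemma cosh_form_ge r s d : 0 <= r -> 0 <= s -> cosh (r - s) <= cosh_form r s d.
Proof.
move=> r0 s0; rewrite /cosh_form coshB lerB // ler_piMr ?cos_le1 //.
by rewrite mulr_ge0 ?sinh_ge0.
Qed.

Lemma dist_planeP (x y : plane R) : 0 <= dist_plane x y /\
  cosh (dist_plane x y) = cosh_form (rho x) (rho y) (phi x - phi y).
Proof.
apply: (@theP R 0 [set t | 0 <= t /\ cosh t = _]).
have [|t t0 e] := @cosh_surj (cosh_form (rho x) (rho y) (phi x - phi y)).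
  by apply: le_trans (cosh_form_ge _ (rho_ge0 x) (rho_ge0 y)); exact: cosh_ge1.
by exists t.
Qed.

Lemma dist_plane_ge0 (x y : plane R) : 0 <= dist_plane x y.
Proof. by case: (dist_planeP x y). Qed.

Lemma cosh_dist (x y : plane R) :
  cosh (dist_plane x y) = cosh_form (rho x) (rho y) (phi x - phi y).
Proof. by case: (dist_planeP x y). Qed.

Lemma dist_planexx (x : plane R) : dist_plane x x = 0.
Proof.
apply/eqP; rewrite eq_le dist_plane_ge0 andbT; apply: cosh_le => //.
by rewrite cosh_dist /cosh_form subrr cos0 mulr1 cosh0 -!expr2 cosh2Bsinh2.
Qed.

Lemma dist_planeC (x y : plane R) : dist_plane x y = dist_plane y x.
Proof.
by apply/eqP; rewrite eq_le; apply/andP; split; apply: cosh_le;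
  rewrite ?dist_plane_ge0 // !cosh_dist /cosh_form -cosN opprB mulrC
    [sinh (rho _) * _]mulrC.
Qed.

Lemma dist_plane_triangle (x y z : plane R) :
  dist_plane x z <= dist_plane x y + dist_plane y z.
Proof.
apply: cosh_le; first by rewrite addr_ge0 ?dist_plane_ge0.
apply: (cosh_triangle (a := cosh (dist_plane x y)) (b := cosh (dist_plane y z)));
  rewrite ?cosh_ge1 ?dist_plane_ge0 //.
rewrite !cosh_dist /cosh_form !cosB.
have h (p : plane R) : cosh (rho p) ^+ 2 -
    (sinh (rho p) * cos (phi p)) ^+ 2 - (sinh (rho p) * sin (phi p)) ^+ 2 = 1.
  by rewrite ![(sinh _ * _) ^+ 2]exprMn -addrA -opprD -mulrDr cos2Dsin2 mulr1 cosh2Bsinh2.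
move: (h x) (h y) (h z).
move: (cosh (rho x)) (sinh (rho x)) (cos (phi x)) (sin (phi x)) => t1 r1 c1 s1.
move: (cosh (rho y)) (sinh (rho y)) (cos (phi y)) (sin (phi y)) => t2 r2 c2 s2.
move: (cosh (rho z)) (sinh (rho z)) (cos (phi z)) (sin (phi z)) => t3 r3 c3 s3.
move=> h1 h2 h3.
pose a := t1 * t2 - r1 * r2 * (c1 * c2 + s1 * s2).
pose b := t2 * t3 - r2 * r3 * (c2 * c3 + s2 * s3).
pose c := t1 * t3 - r1 * r3 * (c1 * c3 + s1 * s3).
rewrite -/a -/b -/c.
pose g1 := t1 ^+ 2 - (r1 * c1) ^+ 2 - (r1 * s1) ^+ 2.
pose g2 := t2 ^+ 2 - (r2 * c2) ^+ 2 - (r2 * s2) ^+ 2.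
pose g3 := t3 ^+ 2 - (r3 * c3) ^+ 2 - (r3 * s3) ^+ 2.
(* Each constant 1, including the coefficients of the squares, is replaced by the norm [g1], [g2] or
   [g3] that equals it. The resulting Gram determinant is, as a polynomial identity, the square of
   the determinant of the three Minkowski vectors. *)
rewrite (_ : _ - _ = g1 * g2 * g3 + 2 * a * b * c - g3 * a ^+ 2 - g1 * b ^+ 2
   - g2 * c ^+ 2); last by rewrite /g1 /g2 /g3 h1 h2 h3; ring.
rewrite (_ : _ - _ = (t1 * (r2 * c2 * (r3 * s3) - r2 * s2 * (r3 * c3))
  - t2 * (r1 * c1 * (r3 * s3) - r1 * s1 * (r3 * c3))
  + t3 * (r1 * c1 * (r2 * s2) - r1 * s1 * (r2 * c2))) ^+ 2); first exact: sqr_ge0.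
by rewrite /g1 /g2 /g3 /a /b /c; ring.
Qed.

(** Put [T = r1 + r2 - 2 s] and apply [exp d / 2 <= cosh d] to the half-angle form. The bounds on
    [s] say [|r1 - r2| <= T + 2 K], so the first summand is at most [exp (T + 2 K)]; the bound on
    the sine makes the second at most [C exp T]. *)
Lemma cosh_form_le (d r1 r2 a s C K : R) : 0 <= r1 -> 0 <= r2 ->
  cosh d = cosh_form r1 r2 a -> 0 <= K -> 0 < C ->
  s <= r1 + K -> s <= r2 + K ->
  sin (a / 2) ^+ 2 <= C * expR (- (s *+ 2)) ->
  d <= r1 + r2 - s *+ 2 + ln (2 * (expR (K *+ 2) + C)).
Proof.
move=> r1_ge0 r2_ge0 ed K0 C0 sx sy hs.
set T := r1 + r2 - s *+ 2.
have c0 : 0 < 2 * (expR (K *+ 2) + C) by rewrite mulr_gt0 // addr_gt0 // expR_gt0.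
rewrite -ler_expR expRD lnK ?posrE //.
have h1 := expR_cosh (d).
rewrite ed cosh_form_half in h1.
have h2 : cos (a / 2) ^+ 2 * cosh (r1 - r2) <=
    expR (T + K *+ 2).
  apply: (@le_trans _ _ (cosh (r1 - r2))).
    apply: ler_piMl; first exact: le_trans ler01 (cosh_ge1 _).
    by rewrite -[leRHS](cos2Dsin2 (a / 2)) lerDl sqr_ge0.
  by apply: cosh_expR; rewrite /T !mulr2n; lra.
have h3 : sin (a / 2) ^+ 2 * cosh (r1 + r2) <= C * expR T.
  rewrite /T [in leRHS]addrC expRD mulrA; apply: ler_pM => //; first exact: sqr_ge0.
    exact: le_trans ler01 (cosh_ge1 _).
  by apply: cosh_expR; lra.
rewrite expRD in h2.
move: (expR T) (expR (K *+ 2)) (expR (d)) h1 h2 h3 => A B D h1 h2 h3.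
by lra.
Qed.

(** Only the sine summand of the half-angle form is kept. The constant [c / 2] comes from
    [exp u / 2 <= cosh u], used for [u = r1 + r2], and [cosh d <= exp d]. *)
Lemma cosh_form_ge_half (d r1 r2 a s c : R) : 0 <= d -> cosh d = cosh_form r1 r2 a -> 0 < c ->
  c * expR (- (s *+ 2)) <= sin (a / 2) ^+ 2 ->
  r1 + r2 - s *+ 2 + ln (c / 2) <= d.
Proof.
move=> d0 ed c0 hs; rewrite -ler_expR expRD lnK ?posrE ?divr_gt0 //.
apply: (@le_trans _ _ (cosh (d))); last first.
  by apply: cosh_expR => //; lra.
rewrite ed cosh_form_half.
apply: (@le_trans _ _ (sin (a / 2) ^+ 2 * cosh (r1 + r2))).
  rewrite [X in X * _ <= _]expRD.
  rewrite [leLHS](_ : _ = c * expR (- (s *+ 2)) * (expR (r1 + r2) / 2)); last by ring.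
  apply: ler_pM => //; last exact: expR_cosh.
    by rewrite mulr_ge0 ?expR_ge0 // ltW.
by rewrite lerDr mulr_ge0 ?sqr_ge0 // (le_trans ler01 (cosh_ge1 _)).
Qed.

Lemma circle_rep t : exists u, [/\ in_circle u, cos u = cos t & sin u = sin t].
Proof.
have p0 : 0 < 2 * pi :> R by rewrite mulr_gt0 // pi_gt0.
pose q := t / (2 * pi); pose z := Num.floor q.
have per (f : R -> R) : periodic f (pi *+ 2) ->
    forall a (m : int), f (a + m%:~R * (2 * pi)) = f a.
  move=> pf a [m|m].
    by rewrite -pmulrn mulr_natl mulr_natl (periodicn pf).
  rewrite NegzE mulrNz mulNr -pmulrn mulr_natl mulr_natl.
  by rewrite -[in LHS](periodicn pf m.+1) subrK.
have et : t = q * (2 * pi) by rewrite /q divfK // gt_eqF.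
exists (t + (- z)%:~R * (2 * pi)); split; last 2 first.
- by rewrite per //; exact: cosD2pi.
- by rewrite per //; exact: sinD2pi.
have z1 : z%:~R <= q := floor_le q.
have z2 : q < z%:~R + 1 by have := floorD1_gt q; rewrite intrD.
rewrite /in_circle mulrNz [in X in X + _]et.
clear et per; move: (z%:~R : R) z1 z2 => Z z1 z2; clear z; clearbody q.
move: (2 * pi) p0 => P P0.
apply/andP; split; nra.
Qed.

(** Clamping the radius at 0 makes the construction total. At the origin the angle has to be 0
    whatever [a] is, which is harmless for distances because the angle enters them multiplied by
    [sinh 0]. *)
Lemma polar_plane r a : exists x : plane R, rho x = Num.max 0 r /\
  (rho x != 0 -> cos (phi x) = cos a /\ sin (phi x) = sin a).
Proof.
have r0 : 0 <= Num.max 0 r by rewrite le_max lexx.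
have [u [uc cu su]] := circle_rep a.
have c0 : in_circle (0 : R) by rewrite /in_circle lexx mulr_gt0 // pi_gt0.
case: (eqVneq (Num.max 0 r) 0) => [e|ne].
  by exists (Plane r0 c0 (fun _ => erefl)); rewrite /= e eqxx.
have ne' : Num.max 0 r = 0 -> u = 0 by move=> e; rewrite e eqxx in ne.
by exists (Plane r0 uc ne').
Qed.

Definition polar r a : plane R := projT1 (cid (polar_plane r a)).

Lemma rho_polar r a : rho (polar r a) = Num.max 0 r.
Proof. by case: (projT2 (cid (polar_plane r a))). Qed.

Lemma cosh_dist_polar r a s b : cosh (dist_plane (polar r a) (polar s b)) =
  cosh_form (Num.max 0 r) (Num.max 0 s) (a - b).
Proof.
rewrite cosh_dist !rho_polar /cosh_form !cosB.
have h t c : Num.max 0 t != 0 -> cos (phi (polar t c)) = cos c /\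
    sin (phi (polar t c)) = sin c.
  by move: (projT2 (cid (polar_plane t c))) => [e]; rewrite -/(polar t c) e.
have sinh0 : sinh 0 = 0 :> R by rewrite /sinh oppr0 subrr mul0r.
have [->|/(h r a) [-> ->]] := eqVneq (Num.max 0 r) 0; first by rewrite sinh0 !mul0r.
have [->|/(h s b) [-> ->]] := eqVneq (Num.max 0 s) 0; first by rewrite sinh0 mulr0 !mul0r.
by [].
Qed.

Lemma sin_le t : `|sin t| <= `|t|.
Proof.
wlog t0 : t / 0 <= t.
  move=> h; have [/h //|/ltW t0] := leP 0 t.
  by rewrite -normrN -sinN -[leRHS]normrN; apply: h; rewrite oppr_ge0.
have [|c _] := @MVT_segment R (@sin R) cos 0 t t0.
  exact/continuous_subspaceT/continuous_sin.
by rewrite sin0 !subr0 => ->; rewrite normrM ler_piMl // cos_max.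
Qed.

(** Mean value theorem, on a neighbourhood of 0 where the cosine exceeds 1/2. *)
Lemma sin_ge : exists2 e : R, 0 < e & forall t, `|t| < e -> `|t| / 2 <= `|sin t|.
Proof.
have /cvgrPdist_lt /(_ (2^-1)) [|e /= e0 he] := @continuous_cos R (0 : R).
  by rewrite invr_gt0.
exists e => // t; wlog t0 : t / 0 <= t.
  move=> h; have [/h //|/ltW t0] := leP 0 t.
  by rewrite -normrN -[`|sin t|]normrN -sinN; apply: h; rewrite oppr_ge0.
move=> te; have [|c] := @MVT_segment R (@sin R) cos 0 t t0.
  exact/continuous_subspaceT/continuous_sin.
rewrite in_itv /= => /andP[c0 ct]; rewrite sin0 !subr0 => ->.
have /he : ball (0 : R) e c.
  rewrite /ball /= sub0r normrN ger0_norm //; apply: le_lt_trans ct _.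
  by move: te; rewrite ger0_norm.
rewrite cos0 normrM => h; rewrite mulrC ler_wpM2r // ger0_norm.
  by move: h; rewrite ltr_norml => /andP[_]; lra.
by move: h; rewrite ltr_norml => /andP[_]; lra.
Qed.

(** Half the difference of two distinct points of the fundamental domain is nonzero and lies
    strictly between [- pi] and [pi], so its sine does not vanish; continuity does the rest. *)
Lemma circle_sin t u : in_circle t -> in_circle u -> t != u ->
  exists c e : R, [/\ 0 < c, 0 < e &
    forall a, `|a - (t - u)| < e -> c <= `|sin (a / 2)|].
Proof.
move=> /andP[t0 t1] /andP[u0 u1] tu.
have s0 : sin ((t - u) / 2) != 0.
  have [h|h|h] := ltgtP t u; last by rewrite h eqxx in tu.
    rewrite -oppr_eq0 -sinN gt_eqF // sin_gt0_pi //.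
    by apply/andP; split; lra.
  rewrite gt_eqF // sin_gt0_pi //.
  by apply/andP; split; lra.
pose c := `|sin ((t - u) / 2)| / 2.
have c0 : 0 < c by rewrite divr_gt0 // normr_gt0.
have /cvgrPdist_lt /(_ c c0) [e /= e0 he] := @continuous_sin R ((t - u) / 2).
exists c, e; split=> // a ha.
have /he h : ball ((t - u) / 2) e (a / 2).
  rewrite /ball /= distrC -mulrBl normrM (@ger0_norm _ 2^-1) ?invr_ge0 //.
  by have := normr_ge0 (a - (t - u)); lra.
have := lerB_dist (sin ((t - u) / 2)) (sin (a / 2)).
move: h; rewrite /c.
move: (`|sin ((t - u) / 2)|) (`|sin (a / 2)|) (`|_ - _|) => x y z.
by lra.
Qed.

End Hyperbolic.

(** * Magnitudes *)

Section Magnitudes.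
Variables (R : realType) (M : model R).
Implicit Types (p : spoint M) (x y z : hreal M) (F G : set R -> R) (e K : R).

Lemma near_genN p (P : set R -> Prop) :
  ~ (\forall w \near gen p, P w) -> \forall w \near gen p, ~ P w.
Proof. by move=> h; have [//|] := in_ultra_setVsetC [set w | P w] (gen_ultra p). Qed.

Lemma cover_seq (X : Type) (n : nat) (code : X -> level R n) (ic : injective code)
    (c : set R -> X) (cX : covers c) (T : eqType)
    (f : T -> star_set M (range code)) (s : seq T) :
  exists p, forall t, t \in s -> exists F : set R -> X, f t = value ic p F.
Proof.
elim: s => [|t s [p hp]]; first by have [p _] := hval_cover (hstd 0 : hreal M); exists p.
have [q eG] := value_cover ic cX (f t).
have [r [a [b [ha hb]]]] := value_merge p q.
exists r => u; rewrite inE => /predU1P[->|/hp [F ->]].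
  by exists (c \o b); rewrite eG hb.
by exists (F \o a); rewrite ha.
Qed.

Lemma hcover_seq (T : eqType) (f : T -> hreal M) (s : seq T) :
  exists p, forall t, t \in s -> exists F, f t = hval p F.
Proof. exact: (@cover_seq _ _ _ (@real_code_inj R) _ (@real_covers R)). Qed.

Lemma cover2 x y : exists p F G, x = hval p F /\ y = hval p G.
Proof.
have [p h] := @hcover_seq {classic hreal M} id [:: x; y].
have [F hF] : exists F, x = hval p F by apply: h; rewrite !inE eqxx.
have [G hG] : exists F, y = hval p F by apply: h; rewrite !inE eqxx orbT.
by exists p, F, G.
Qed.

Lemma cover4 x y z t : exists p F G F' G',
  [/\ x = hval p F, y = hval p G, z = hval p F' & t = hval p G'].
Proof.
have [p h] := @hcover_seq {classic hreal M} id [:: x; y; z; t].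
have [F hF] : exists F, x = hval p F by apply: h; rewrite !inE eqxx.
have [G hG] : exists F, y = hval p F by apply: h; rewrite !inE eqxx orbT.
have [F' hF'] : exists F, z = hval p F by apply: h; rewrite !inE eqxx !orbT.
have [G' hG'] : exists F, t = hval p F by apply: h; rewrite !inE eqxx !orbT.
by exists p, F, G, F', G'.
Qed.

Lemma hval_neq0 p F : hval p F <> hstd 0 <-> \forall w \near gen p, F w != 0.
Proof.
rewrite (hstd_hval p) hval_eq; split=> [/near_genN h|h h'].
  by apply: filterS h => w /eqP.
by have [w [/eqP]] := filter_ex (filterI h h'); apply.
Qed.

(** This means [|x| <= K |y|]. Only [hlt] is available on hyperreals, hence the negation, which the
    ultrafilter turns into an inequality almost everywhere. *)
Definition le_mag K x y := ~ hlt (hmul (hstd K) (habs y)) (habs x).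

Lemma le_mag_hval K p F G :
  le_mag K (hval p F) (hval p G) <-> \forall w \near gen p, `|F w| <= K * `|G w|.
Proof.
rewrite /le_mag (hstd_hval p) !hvalE hlt_hval; split=> [/near_genN h|h h'].
  by apply: filterS h => w /negP; rewrite -leNgt.
by have [w [h1 /=]] := filter_ex (filterI h h'); rewrite ltNge h1.
Qed.

Lemma le_mag_trans K L x y z : 0 <= K ->
  le_mag K x y -> le_mag L y z -> le_mag (K * L) x z.
Proof.
move=> K0; have [p [F [G [H [_ [-> -> -> _]]]]]] := cover4 x y z z.
rewrite !le_mag_hval => h1 h2; apply: filterS (filterI h1 h2) => w [/= h3 h4].
by apply: le_trans h3 _; rewrite -mulrA ler_wpM2l.
Qed.

Definition much_smaller x y := forall e, 0 < e -> le_mag e x y.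

Lemma same_magnitudeE (x y : hnonzero M) : same_magnitude x y <->
  exists K, [/\ 0 < K, le_mag K (sval x) (sval y) & le_mag K (sval y) (sval x)].
Proof.
case: x => x x0; case: y => y y0; rewrite /same_magnitude /=.
have [p [F [G [ex ey]]]] := cover2 x y; subst x y.
rewrite !hvalE !hfinite_hval.
move: x0 y0 => /hval_neq0 x0 /hval_neq0 y0.
split=> [[[K hK] [L hL]]|[K [K0]]].
  exists (Num.max 1 (Num.max K L)); split; rewrite ?le_mag_hval ?lt_max ?ltr01 //.
    apply: filterS (filterI hK y0) => w [/= h1 h2].
    rewrite -ler_pdivrMr ?normr_gt0 // -normrV ?unitfE // -normrM.
    by apply: le_trans (ltW h1) _; rewrite !le_max lexx orbT.
  apply: filterS (filterI hL x0) => w [/= h1 h2].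
  rewrite -ler_pdivrMr ?normr_gt0 // -normrV ?unitfE // -normrM.
  by apply: le_trans (ltW h1) _; rewrite !le_max lexx !orbT.
rewrite !le_mag_hval => h1 h2; split; exists (K + 1).
  apply: filterS (filterI h1 y0) => w [/= h3 h4].
  rewrite normrM normrV ?unitfE // ltr_pdivrMr ?normr_gt0 //.
  by rewrite mulrDl mul1r (le_lt_trans h3) // ltrDl normr_gt0.
apply: filterS (filterI h2 x0) => w [/= h3 h4].
rewrite normrM normrV ?unitfE // ltr_pdivrMr ?normr_gt0 //.
by rewrite mulrDl mul1r (le_lt_trans h3) // ltrDl normr_gt0.
Qed.

Lemma le_mag_refl x : le_mag 1 x x.
Proof.
have [p [F ->]] := hval_cover x; rewrite le_mag_hval.
by apply: filterE => w; rewrite mul1r.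
Qed.

Lemma same_mag_refl (x : hnonzero M) : same_magnitude x x.
Proof. by apply/same_magnitudeE; exists 1; split=> //; exact: le_mag_refl. Qed.

Lemma same_mag_sym (x y : hnonzero M) : same_magnitude x y -> same_magnitude y x.
Proof. by case=> h1 h2; split. Qed.

Lemma same_mag_trans (y x z : hnonzero M) :
  same_magnitude x y -> same_magnitude y z -> same_magnitude x z.
Proof.
move=> /same_magnitudeE [K [K0 h1 h2]] /same_magnitudeE [L [L0 h3 h4]].
apply/same_magnitudeE; exists (K * L); split; first exact: mulr_gt0.
  exact: le_mag_trans (ltW K0) h1 h3.
by rewrite mulrC; exact: le_mag_trans (ltW L0) h4 h2.
Qed.

Lemma lam_eq (x y : hnonzero M) : lam x = lam y <-> same_magnitude x y.
Proof.
split=> [/(congr1 sval) /= ->|h]; first exact: same_mag_refl.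
apply: eq_exist; apply/funext => z; apply/propext; split.
  by apply: same_mag_trans; exact: same_mag_sym.
exact: same_mag_trans.
Qed.

(** Failure for one [e] gives the reverse bound with [K = e^-1]. This dichotomy makes the order on
    classes total. *)
Lemma not_much_smaller x y : ~ much_smaller x y -> exists2 K, 0 < K & le_mag K y x.
Proof.
have [p [F [G [-> ->]]]] := cover2 x y => h.
have [e [e0]] : exists e, 0 < e /\ ~ le_mag e (hval p F) (hval p G).
  apply: contrapT => ne; apply: h => e e0; apply: contrapT => h; apply: ne.
  by exists e.
rewrite le_mag_hval => /near_genN h'; exists e^-1; first by rewrite invr_gt0.
rewrite le_mag_hval; apply: filterS h' => w /negP; rewrite -ltNge => /ltW.
by rewrite ler_pdivlMl.
Qed.

Lemma much_smaller_same (x y : hnonzero M) :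
  much_smaller (sval x) (sval y) -> ~ same_magnitude x y.
Proof.
case: x => x x0; case: y => y y0 /= h /same_magnitudeE [K [K0 _ /=]].
(* With this constant the two bounds combine to [|y| <= |y| / 2]. *)
have K2 : 0 < (2 * K)^-1 by rewrite invr_gt0 mulr_gt0.
move: (h _ K2).
have [p [F [G [ex ey]]]] := cover2 x y; subst x y.
move: x0 y0 => /hval_neq0 x0 /hval_neq0 y0.
rewrite !le_mag_hval => h1 h2.
have [w [[/= h3 h4] h5]] := filter_ex (filterI (filterI h1 h2) y0).
have g0 : 0 < `|G w| by rewrite normr_gt0.
have := le_trans h4 (ler_wpM2l (ltW K0) h3).
rewrite (_ : K * _ = `|G w| / 2); first by lra.
by field; rewrite gt_eqF.
Qed.

(** [lam_lt] asks for some pair of representatives; changing them costs a finite factor, which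
    [much_smaller] absorbs. *)
Lemma lam_ltP (x y : hnonzero M) :
  lam_lt (lam x) (lam y) <-> much_smaller (sval x) (sval y).
Proof.
split=> [[ne [x' [y' [/lam_eq xx' /lam_eq yy' lt']]]]|h].
  apply: contrapT => /not_much_smaller [K K0 yx]; apply: ne; apply/lam_eq.
  apply/same_magnitudeE.
  move/same_magnitudeE : xx' => [K1 [K10 h1 _]].
  move/same_magnitudeE : yy' => [K2 [K20 _ h2]].
  have x'y' : le_mag 1 (sval x') (sval y').
    have [p [F [G [e1 e2]]]] := cover2 (sval x') (sval y').
    move: lt'; rewrite e1 e2 le_mag_hval !hvalE hlt_hval.
    by apply: filterS => w; rewrite mul1r => /ltW.
  exists (Num.max K (K1 * 1 * K2)).
  have mono a b K' L : K' <= L -> le_mag K' a b -> le_mag L a b.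
    move=> KL; have [p [F [G [-> ->]]]] := cover2 a b.
    rewrite !le_mag_hval; apply: filterS => w h; apply: le_trans h _.
    exact: ler_wpM2r.
  split; first by rewrite lt_max K0.
  - apply: (mono _ _ (K1 * 1 * K2)); first by rewrite le_max lexx orbT.
    apply: le_mag_trans _ h2; first by rewrite mulr1 ltW.
    by apply: le_mag_trans x'y' => //; exact: ltW.
  - by apply: mono yx; rewrite le_max lexx.
split; first by move=> /lam_eq; exact: much_smaller_same.
exists x, y; split=> //.
have : le_mag 2^-1 (sval x) (sval y) by apply: h; rewrite invr_gt0.
case: y {h} => y y0 /=; case: x => x x0 /=.
have [p [F [G [e1 e2]]]] := cover2 x y; subst x y.
move: y0 => /hval_neq0 y0.
rewrite le_mag_hval !hvalE hlt_hval => h; apply: filterS (filterI h y0) => w [/= h1 h2].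
have : 0 < `|G w| by rewrite normr_gt0.
by lra.
Qed.

Lemma lam_surj (l : Lambda M) : exists x : hnonzero M, l = lam x.
Proof. by exists (rep l); rewrite /lam repP. Qed.

Lemma lam_total (l m : Lambda M) : [\/ l = m, lam_lt l m | lam_lt m l].
Proof.
have [x ->] := lam_surj l; have [y ->] := lam_surj m.
have [h|/not_much_smaller [K K0 h]] := pselect (much_smaller (sval x) (sval y)).
  by apply: Or32; apply/lam_ltP.
have [h'|/not_much_smaller [L L0 h']] := pselect (much_smaller (sval y) (sval x)).
  by apply: Or33; apply/lam_ltP.
apply: Or31; apply/lam_eq/same_magnitudeE.
have mono a b K' N : K' <= N -> le_mag K' a b -> le_mag N a b.
  move=> KL; have [p [F [G [-> ->]]]] := cover2 a b.
  rewrite !le_mag_hval; apply: filterS => w h1; apply: le_trans h1 _.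
  exact: ler_wpM2r.
exists (Num.max K L); split; first by rewrite lt_max K0.
- by apply: mono h'; rewrite le_max lexx orbT.
- by apply: mono h; rewrite le_max lexx.
Qed.

Lemma lam_lt_trans (m l n : Lambda M) : lam_lt l m -> lam_lt m n -> lam_lt l n.
Proof.
have [x ->] := lam_surj l; have [y ->] := lam_surj m; have [z ->] := lam_surj n.
move=> /lam_ltP h1 /lam_ltP h2; apply/lam_ltP => e e0.
by rewrite -[e]mulr1; apply: le_mag_trans (h1 _ e0) (h2 _ ltr01); exact: ltW.
Qed.

Lemma lam_lt_irr (l : Lambda M) : ~ lam_lt l l.
Proof. by case. Qed.

Lemma lam_lt_asym (l m : Lambda M) : lam_lt l m -> ~ lam_lt m l.
Proof. by move=> h1 h2; exact: lam_lt_irr (lam_lt_trans h1 h2). Qed.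

Lemma lam_le_trans (m l n : Lambda M) : lam_le l m -> lam_le m n -> lam_le l n.
Proof.
move=> [->//|h1] [<-|h2]; right=> //; exact: lam_lt_trans h1 h2.
Qed.

(** * The representatives of the classes and the function g *)

Section Scale.
Variables (eps : hreal M) (prec : hreal M -> hreal M -> Prop).
Hypotheses (eps_gt0 : hlt (hstd 0) eps) (eps_inf : infinitesimal eps)
  (prec_wo : initial_well_order prec).
Implicit Types (l m : Lambda M).

Lemma hnonzero_inj (x y : hnonzero M) : sval x = sval y -> x = y.
Proof. by case: x y => [x x0] [y y0] /= e; apply: eq_exist. Qed.

(** The well-order supplies a minimal representative, so [the] does not fall back on its default
    [hone M]. *)
Lemma lam_choiceK l : lam (lam_choice prec l) = l.
Proof.
rewrite /lam_choice; case: (pselect _) => [e|ne] /=; first by rewrite e.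
case: prec_wo => -[_ _ wo] _.
have [x lx] := lam_surj l.
pose B := [set x | exists2 y : hnonzero M, x = sval y & lam y = l].
have [|_ [x0 -> lx0] x0min] := wo B (fun _ _ => I).
  by exists (sval x), x.
have ex : exists x : hnonzero M, lam x = l /\
    forall y : hnonzero M, lam y = l -> y <> x -> prec (sval x) (sval y).
  exists x0; split; first exact lx0.
  move=> y ly yx0.
  have By : B (sval y) by exists y.
  by clear -x0min yx0 By; case: (x0min _ By) => [/hnonzero_inj /yx0 [] | h].
exact (proj1 (theP (hone M) ex)).
Qed.

Definition scale l : hreal M := sval (lam_choice prec l).

Lemma scale_neq0 l : scale l <> hstd 0.
Proof. exact: (svalP (lam_choice prec l)). Qed.

Lemma scale_lam0 : scale lam0 = hstd 1.
Proof. by rewrite /scale /lam_choice; case: (pselect _). Qed.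

Lemma lam_lt_scale l m : lam_lt l m <-> much_smaller (scale l) (scale m).
Proof. by rewrite -lam_ltP !lam_choiceK. Qed.

Lemma scale_le1 l p F : scale l = hval p F -> lam_le l lam0 ->
  \forall w \near gen p, `|F w| <= 1.
Proof.
move=> e [e0|/lam_lt_scale].
  move: e; rewrite e0 scale_lam0 (hstd_hval p) hval_eq; apply: filterS => w <-.
  by rewrite normr1.
rewrite scale_lam0 e (hstd_hval p) => /(_ _ ltr01); rewrite le_mag_hval.
by apply: filterS => w; rewrite normr1 mulr1.
Qed.

Lemma eps_near p E : eps = hval p E ->
  forall e, 0 < e -> \forall w \near gen p, 0 < E w < e.
Proof.
move=> eE e e0; move: eps_gt0 eps_inf; rewrite eE (hstd_hval p) hlt_hval.
rewrite infinitesimal_hval => h1 /(_ _ e0) h2.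
apply: filterS (filterI h1 h2) => w [/= h3].
by rewrite gtr0_norm // => h4; apply/andP.
Qed.

Lemma scale_near0 l p F : scale l = hval p F -> \forall w \near gen p, F w != 0.
Proof. by move=> e; apply/hval_neq0; rewrite -e; exact: scale_neq0. Qed.

Lemma lam_gE l p E F : eps = hval p E -> scale l = hval p F ->
  (exists K, \forall w \near gen p, `|E w * ln `|F w| | < K) /\
    (exists2 r, lam_g eps prec l = r%:E & hclose p (fun w => - (E w * ln `|F w|)) r)
  \/ lam_g eps prec l = +oo%E /\
    ~ (exists K, \forall w \near gen p, `|E w * ln `|F w| | < K).
Proof.
move=> eE eF; rewrite /lam_g -/(scale l) eE eF !hvalE.
have fin : hfinite (hval p (fun w => - (E w * ln `|F w|))) <->
    exists K, \forall w \near gen p, `|E w * ln `|F w| | < K.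
  by rewrite hfinite_hval; split=> -[K h]; exists K; apply: filterS h => w;
    rewrite normrN.
case: (pselect _) => [h|h]; [left|right]; split=> //.
- exact/fin.
- by exists (st (hval p (fun w => - (E w * ln `|F w|)))) => //; exact: st_finite.
- by move=> /fin.
Qed.

Lemma hclose_le p F G r s : (\forall w \near gen p, F w <= G w) ->
  hclose p F r -> hclose p G s -> r <= s.
Proof.
move=> h hr hs; rewrite leNgt; apply/negP => rs.
have e0 : 0 < (r - s) / 2 by lra.
have [w [[h1 /ltr_normlP[h2 h3]] /ltr_normlP[h4 h5]]] :=
  filter_ex (filterI (filterI h (hr _ e0)) (hs _ e0)).
by rewrite /= in h1; lra.
Qed.

(** From [|a_l| <= |a_m| <= 1] follows [0 <= - eps log |a_m| <= - eps log |a_l|]; the lower bound 0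
    carries finiteness over from [l] to [m]. *)
Lemma lam_g_anti l m : lam_le l m -> lam_le m lam0 ->
  (lam_g eps prec m <= lam_g eps prec l)%E.
Proof.
move=> [-> //|lm] m0.
have [p [E [F [G [_ [eE eF eG _]]]]]] := cover4 eps (scale l) (scale m) eps.
have [[[K hK] [r -> hr]]|[-> _]] := lam_gE eE eF; last by rewrite leey.
have e := eps_near eE ltr01.
have F0 := scale_near0 eF; have G0 := scale_near0 eG.
have G1 := scale_le1 eG m0.
move/lam_lt_scale: (lm); rewrite eF eG => /(_ _ ltr01); rewrite le_mag_hval => FG.
have key : \forall w \near gen p,
    0 <= - (E w * ln `|G w|) <= - (E w * ln `|F w|).
  apply: filterS (filterI (filterI e (filterI F0 G0)) (filterI G1 FG)).
  move=> w [[/= /andP[e0 _] [f0 g0]] [g1]]; rewrite mul1r => fg.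
  rewrite -!mulrN pmulr_rge0 // ler_pM2l // lerN2 oppr_ge0 ln_le0 //=.
  by rewrite ler_ln // posrE normr_gt0.
have [[_ [s -> hs]]|[_ nf]] := lam_gE eE eG.
  rewrite lee_fin; apply: hclose_le hs hr.
  by apply: filterS key => w /andP[].
exfalso; apply: nf; exists K; apply: filterS (filterI hK key) => w [/= h1 /andP[h2 h3]].
by apply: le_lt_trans h1; rewrite -normrN (ger0_norm h2) -[leRHS]normrN
  (ger0_norm (le_trans h2 h3)).
Qed.

(** Needed when one function extends the other: just below the higher end one of the two is
    undefined, and the supremum in [F_sup] is [g] of that end only if [g] takes values arbitrarily
    close to it on lower classes. *)
Lemma lam_g_next l r h : lam_le l lam0 -> lam_g eps prec l = r%:E -> r < h ->
  exists m, lam_lt m l /\ (lam_g eps prec m < h%:E)%E.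
Proof.
move=> l0 gl rh; have [p [E [F [eE eF]]]] := cover2 eps (scale l).
(* The witness is the class of [a_l exp (- t / eps)]. As [t / eps] is infinite the class is strictly
   lower, while [- eps log] grows by [t] only, half of the margin. *)
pose t := (h - r) / 2; have t0 : 0 < t by rewrite divr_gt0 // subr_gt0.
pose B w := F w * expR (- (t / E w)).
have F0 := scale_near0 eF.
have Bneq0 : hval p B <> hstd 0.
  apply/hval_neq0; apply: filterS F0 => w h0.
  by rewrite mulf_neq0 // gt_eqF // expR_gt0.
pose b : hnonzero M := exist _ (hval p B) Bneq0.
have bl : lam_lt (lam b) l.
  rewrite -(lam_choiceK l); apply/lam_ltP => /= e e0; rewrite -/(scale l) eF.
  apply/le_mag_hval; pose q := Num.max 1 (- ln e).
  have q0 : 0 < q by rewrite lt_max ltr01.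
  have tq : 0 < t / q by rewrite divr_gt0.
  apply: filterS (eps_near eE tq) => w /andP[h1 h2].
  rewrite /B normrM mulrC ler_wpM2r // gtr0_norm ?expR_gt0 //.
  rewrite -[leRHS]lnK ?posrE // ler_expR lerNl.
  apply: (@le_trans _ _ q); first by rewrite le_max lexx orbT.
  by rewrite ler_pdivlMr // mulrC -ler_pdivlMr // ltW.
exists (lam b); split=> //.
have [q [E' [B' [F' [G' [eE' eB' eF' eG']]]]]] :=
  cover4 eps (hval p B) (scale l) (scale (lam b)).
(* The representative chosen in the class of [b] need not be a value at [p], so a new point [q] is
   used; writing [b] with the operations of the hyperreals recovers its formula there. *)
have B'E : \forall w \near gen q, `|B' w| = `|F' w| * expR (- (t / E' w)).
  have : hval p B = hmul (scale l) (ext1 (fun x : R => expR (- x))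
      (hmul (hstd t) (hinv eps))).
    rewrite eF eE (hstd_hval p) !hvalE.
    have -> G : ext1 (fun x : R => expR (- x)) (hval p G) =
        hval p (fun w => expR (- G w)) by exact: ext1_value.
    by rewrite hvalE.
  rewrite eB' eF' eE' (hstd_hval q) !hvalE.
  have -> G : ext1 (fun x : R => expR (- x)) (hval q G) =
      hval q (fun w => expR (- G w)) by exact: ext1_value.
  rewrite hvalE hval_eq; apply: filterS => w ->.
  by rewrite normrM [X in _ * X]gtr0_norm // expR_gt0.
have [[_ [s]]|[]] := lam_gE eE' eF'; rewrite gl // => -[<-] hr.
have : same_magnitude b (lam_choice prec (lam b)).
  by apply/lam_eq; rewrite lam_choiceK.
move=> /same_magnitudeE [K [K0 /=]]; rewrite -/(scale _) eB' eG' !le_mag_hval.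
move=> BG _.
have F0' := scale_near0 eF'; have G0' := scale_near0 eG'.
have m0 : lam_le (lam b) lam0 by apply: lam_le_trans l0; right.
(* The chosen representative is at least [|b| / K] in absolute value, which costs the infinitesimal
   [eps log K]. *)
have upper : \forall w \near gen q,
   0 <= - (E' w * ln `|G' w|) <= - (E' w * ln `|F' w|) + t + E' w * ln K.
  apply: filterS (filterI (filterI B'E BG) (filterI (filterI F0' G0')
    (filterI (eps_near eE' ltr01) (scale_le1 eG' m0)))).
  move=> w [[/= h1 h2] [[h3 h4] [/andP[h5 _] h6]]].
  rewrite h1 in h2.
  have f0 : 0 < `|F' w| by rewrite normr_gt0.
  have g0 : 0 < `|G' w| by rewrite normr_gt0.
  have /= := h2; rewrite -ler_ln ?posrE ?mulr_gt0 ?expR_gt0 //.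
  rewrite !lnM ?posrE ?expR_gt0 // expRK => h7.
  apply/andP; split; first by rewrite -mulrN pmulr_rge0 // oppr_ge0 ln_le0.
  have : E' w * (ln `|F' w| - t / E' w) <= E' w * (ln K + ln `|G' w|).
    by rewrite ler_pM2l.
  rewrite mulrBr [E' w * (t / _)]mulrC divfK ?gt_eqF // mulrDr.
  by lra.
have lnK e : 0 < e -> \forall w \near gen q, `|E' w * ln K| < e.
  move=> e0; pose k := `|ln K| + 1.
  have k0 : 0 < k by rewrite ltr_wpDl.
  apply: filterS (eps_near eE' (divr_gt0 e0 k0)) => w /andP[h1].
  rewrite ltr_pdivlMr // normrM gtr0_norm //; apply: le_lt_trans.
  by rewrite ler_pM2l // lerDl.
have hup : hclose q (fun w => - (E' w * ln `|F' w|) + t + E' w * ln K) (r + t).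
  move=> e e0; have e2 : 0 < e / 2 by rewrite divr_gt0.
  apply: filterS (filterI (hr _ e2) (lnK _ e2)) => w [/= /ltr_normlP[h1 h2]].
  by move=> /ltr_normlP[h3 h4]; apply/ltr_normlP; split; lra.
have [[_ [g -> hg]]|[_ nf]] := lam_gE eE' eG'.
  rewrite lte_fin; apply: (@le_lt_trans _ _ (r + t)); last by rewrite /t; lra.
  by apply: hclose_le hg hup; apply: filterS upper => w /andP[].
exfalso; apply: nf; exists (r + t + 1).
apply: filterS (filterI upper (hup _ ltr01)) => w [/= /andP[h1 h2] /ltr_normlP[h3 h4]].
by rewrite -normrN (ger0_norm h1); lra.
Qed.

End Scale.

End Magnitudes.

(** * Branching of two pairs *)

Section Pairs.
Variables (R : realType) (M : model R).
Variables (eps : hreal M) (prec : hreal M -> hreal M -> Prop).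
Hypotheses (eps_gt0 : hlt (hstd 0) eps) (eps_inf : infinitesimal eps)
  (prec_wo : initial_well_order prec).
Implicit Types (l m : Lambda M) (P Q : Fpair eps prec).
Local Notation g := (lam_g eps prec).
Local Notation scale := (scale prec).

Lemma lam_g_fin l : (g l < +oo)%E -> exists r, g l = r%:E.
Proof.
have [p [E [F [eE eF]]]] := cover2 eps (scale l).
have [[_ [r -> _]]|[-> _]] := lam_gE eE eF; last by rewrite ltxx.
by exists r.
Qed.

Lemma F_agreeC P Q l : F_agree P Q l <-> F_agree Q P l.
Proof. by split=> -[t [h1 h2]]; exists t. Qed.

Lemma F_supC P Q : F_sup P Q = F_sup Q P.
Proof.
congr (sup _); apply/seteqP; split=> h /= hh l l0 /hh => /(_ l0);
  by rewrite F_agreeC.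
Qed.

(** As [g] is antitone, [g m < r] forces [m] above [l], so [r] belongs to the set; the second
    hypothesis makes [r] an upper bound. *)
Lemma F_sup_eq P Q l r : lam_le l lam0 -> g l = r%:E ->
  (forall m, lam_lt l m -> lam_le m lam0 -> F_agree P Q m) ->
  (forall h, r < h -> exists m, [/\ lam_le m lam0, (g m < h%:E)%E
     & ~ F_agree P Q m]) ->
  F_sup P Q = r.
Proof.
move=> l0 gl agr dis; rewrite /F_sup; set A := (X in sup X).
have Ar : A r.
  move=> m m0 gm; apply: agr => //.
  have [e|//|ml] := lam_total l m; first by move: gm; rewrite -e gl ltxx.
  have := lam_g_anti eps_gt0 eps_inf prec_wo (or_intror ml) l0.
  by rewrite gl leNgt gm.
have ubA : ubound A r.
  move=> h Ah; rewrite leNgt; apply/negP => /dis [m [m0 gm]]; apply.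
  exact: Ah.
apply/eqP; rewrite eq_le ge_sup //=; last by exists r.
by apply: ub_le_sup => //; exists r.
Qed.

Lemma fn_some P l : lam_le (low P) l -> lam_le l lam0 -> exists t, fn P l = Some t.
Proof.
move=> h1 h2; have := (fn_dom P l).2 (conj h1 h2).
by case: (fn P l) => [t|] // _; exists t.
Qed.

Lemma fn_range P l t : fn P l = Some t -> lam_le (low P) l /\ lam_le l lam0.
Proof. by move=> e; apply/fn_dom; rewrite e. Qed.

(** The default 0 allows sums over arbitrary finite sets of classes, even above [lam0]. *)
Definition coef P l : R := if fn P l is Some t then t else 0.

Definition differ P Q l := exists t u, [/\ fn P l = Some t, fn Q l = Some u & t != u].

Lemma not_differ P Q l : lam_le (low P) l -> lam_le (low Q) l -> lam_le l lam0 ->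
  ~ differ P Q l -> F_agree P Q l.
Proof.
move=> h1 h2 h3 nd; have [t ht] := fn_some h1 h3; have [u hu] := fn_some h2 h3.
exists t; split=> //; rewrite hu; congr Some.
by apply/eqP; apply: contraT => /negP ne; exfalso; apply: nd; exists t, u; split=> //;
  rewrite eq_sym; apply/negP.
Qed.

Lemma F_agree_coef P Q l : F_agree P Q l -> coef P l = coef Q l.
Proof. by move=> [t [h1 h2]]; rewrite /coef h1 h2. Qed.

Lemma coef_out P l : ~ lam_le l lam0 -> coef P l = 0.
Proof. by rewrite /coef; case e: (fn P l) => [t|] // []; exact: (fn_range e).2. Qed.

(** Well-ordering for the reverse order provides largest elements, and the larger of the two maxima
    serves. It is applied to the classes of disagreement, which lie in the union of two supports. *)
Lemma max_of_union (S T B : set (Lambda M)) :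
  strict_well_order (fun l m => lam_lt m l) S ->
  strict_well_order (fun l m => lam_lt m l) T ->
  B `<=` S `|` T -> B !=set0 ->
  exists2 l, B l & forall m, B m -> m = l \/ lam_lt m l.
Proof.
move=> [_ _ wS] [_ _ wT] BST B0.
have [SB0|SB0] := pselect (B `&` S !=set0); last first.
  apply: wT => // m Bm; case: (BST _ Bm) => // Sm.
  by case: SB0; exists m.
have [TB0|TB0] := pselect (B `&` T !=set0); last first.
  apply: wS => // m Bm; case: (BST _ Bm) => // Tm.
  by case: TB0; exists m.
have [x [Bx Sx] hx] := wS (B `&` S) (@subIsetr _ _ _) SB0.
have [y [By Ty] hy] := wT (B `&` T) (@subIsetr _ _ _) TB0.
have key (l m : Lambda M) : m = l \/ lam_lt m l -> forall n, lam_lt l n ->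
    n = n /\ lam_lt m n.
  by move=> [->//|ml] n ln; split=> //; exact: lam_lt_trans ml ln.
have [xy|xy|yx] := lam_total x y.
- exists x => // m Bm; case: (BST _ Bm) => h; first by apply: hx.
  by rewrite xy; apply: hy.
- exists y => // m Bm; case: (BST _ Bm) => h; last by apply: hy.
  by right; apply: (key x m (hx _ (conj Bm h)) y xy).2.
- exists x => // m Bm; case: (BST _ Bm) => h; first by apply: hx.
  by right; apply: (key y m (hy _ (conj Bm h)) x yx).2.
Qed.

(** The place where two pairs part, in the form used by the estimates: above [l] the coefficients
    cancel; at [l] either the values differ, and the angle bounds the distance from below, or [l] is
    the end of a pair, and the radii do. *)
Definition branching P Q l r :=
  [/\ lam_le l lam0, g l = r%:E, F_sup P Q = r, lam_le (low P) l &
     lam_le (low Q) l] /\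
  (forall m, lam_lt l m -> coef P m = coef Q m) /\
  (differ P Q l \/ (coef P l = coef Q l /\ (l = low P \/ l = low Q))).

Lemma branchingC P Q l r : branching P Q l r -> branching Q P l r.
Proof.
move=> [[h1 h2 h3 h4 h5] [h6 h7]]; split; first by rewrite F_supC.
split; first by move=> m /h6.
case: h7 => [[t [u [e1 e2 e3]]]|[-> h]]; last by right; split=> //; case: h; [right|left].
by left; exists u, t; split=> //; rewrite eq_sym.
Qed.

Lemma branching_low P Q : lam_le (low P) (low Q) -> (forall l, ~ differ P Q l) ->
  exists l r, branching P Q l r.
Proof.
move=> PQ nd; exists (low Q); have [r gr] := lam_g_fin (low_fin Q); exists r.
have agr m : lam_le (low Q) m -> lam_le m lam0 -> F_agree P Q m.
  by move=> h1 h2; apply: not_differ => //; apply: lam_le_trans PQ h1.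
have Q0 := low_le Q.
split.
  split=> //; last by left.
  apply: F_sup_eq (gr) _ _ => // [m h1 h2|h /(lam_g_next eps_gt0 eps_inf prec_wo Q0 gr)].
    by apply: agr => //; right.
  move=> [m [mQ gm]]; exists m; split=> //.
    by apply: lam_le_trans Q0; right.
  move=> [t [_ /fn_range [[e|Qm] _]]]; first by apply: (@lam_lt_irr _ _ m); rewrite -{2}e.
  exact: lam_lt_asym mQ Qm.
split; last by right; split; [apply/F_agree_coef/agr => //; left|right].
move=> m Qm; have [m0|m0] := pselect (lam_le m lam0); last by rewrite !coef_out.
by apply/F_agree_coef/agr => //; right.
Qed.

Lemma branching_exists P Q : exists l r, branching P Q l r.
Proof.
have [[l0 d0]|nd] := pselect (exists l, differ P Q l); last first.
  have nd' l : ~ differ P Q l by move=> h; apply: nd; exists l.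
  have [e|h|h] := lam_total (low P) (low Q).
  - by apply: branching_low => //; left.
  - by apply: branching_low => //; right.
  - have [||l [r /branchingC b]] := @branching_low Q P; first by right.
      by move=> l [t [u [h1 h2 h3]]]; apply: (nd' l); exists u, t; rewrite eq_sym.
    by exists l, r.
have [S [wS _ zS]] := fn_supp P; have [T [wT _ zT]] := fn_supp Q.
have [||l [t [u [ht hu tu]]] lmax] := @max_of_union S T (differ P Q) wS wT.
- move=> l [t [u [ht hu tu]]].
  have [Sl|nS] := pselect (S l); first by left.
  have [Tl|nT] := pselect (T l); first by right.
  by move: tu; rewrite (zS _ _ ht nS) (zT _ _ hu nT) eqxx.
- by exists l0.
have [Pl l1] := fn_range ht; have [Ql _] := fn_range hu.
have [r gr] : exists r, g l = r%:E.
  apply: lam_g_fin; apply: le_lt_trans (low_fin P).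
  exact: lam_g_anti.
have agr m : lam_lt l m -> lam_le m lam0 -> F_agree P Q m.
  move=> lm m0; apply: not_differ => //.
  - by apply: lam_le_trans Pl _; right.
  - by apply: lam_le_trans Ql _; right.
  - move=> /lmax [e|ml]; last exact: lam_lt_asym lm ml.
    by apply: (@lam_lt_irr _ _ l); rewrite -{2}e.
exists l, r; split.
  split=> //; apply: F_sup_eq (gr) (agr) _ => // h rh; exists l; split=> //.
    by rewrite gr lte_fin.
  move=> [v [h1 h2]]; move: tu.
  by move: ht hu; rewrite h1 h2 => -[<-] [<-]; rewrite eqxx.
split; last by left; exists t, u.
move=> m lm; have [m0|m0] := pselect (lam_le m lam0); last by rewrite !coef_out.
exact/F_agree_coef/agr.
Qed.

(** Halving [e] at each term is possible because the list has a standard finite length. *)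
Lemma sum_small (p : spoint M) (T : eqType) (s : seq T) (H : T -> set R -> R) (L : set R -> R) :
  (forall t, t \in s -> forall e, 0 < e -> \forall w \near gen p, `|H t w| <= e * `|L w|) ->
  forall e, 0 < e -> \forall w \near (gen p : set_system (set R)),
    `|\sum_(t <- s) H t w| <= e * `|L w|.
Proof.
elim: s => [|t s IH] h e e0.
  by apply: filterE => w; rewrite big_nil normr0 mulr_ge0 // ltW.
have e2 : 0 < e / 2 by rewrite divr_gt0.
have h1 := h t (mem_head _ _) _ e2.
have h2 := IH (fun u us => h u (mem_behead (s := t :: s) us)) _ e2.
apply: filterS (filterI h1 h2) => w [/= h3 h4].
rewrite big_cons; apply: le_trans (ler_normD _ _) _.
by apply: le_trans (lerD h3 h4) _; lra.
Qed.

(** * The distance of two points at a fixed finite set of classes *)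

Section Configuration.
Variables (p : spoint M) (E : set R -> R) (F : Lambda M -> set R -> R).
Variable J : seq {classic Lambda M}.
Hypotheses (eE : eps = hval p E)
  (eF : forall l : {classic Lambda M}, l \in J -> scale l = hval p (F l)).

Definition angle_at P w : R := \sum_(l <- undup J) coef P l * F l w.

Definition config_point P w : plane R :=
  polar (- ln `|F (low P) w|) (angle_at P w).

Section Branch.
Variables (P Q : Fpair eps prec) (l : Lambda M) (r : R).
Hypotheses (PJ : (low P : {classic Lambda M}) \in J)
  (QJ : (low Q : {classic Lambda M}) \in J) (lJ : (l : {classic Lambda M}) \in J).
Hypothesis br : branching P Q l r.

Let D w := angle_at P w - angle_at Q w.
Let k := coef P l - coef Q l.
Let L := F l.
Let d w := dist_plane (config_point P w) (config_point Q w).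

(** Terms above [l] cancel by branching, the term at [l] contributes [k * L], and the finitely many
    lower ones are negligible against [L]. If the values at [l] agree, [k] is 0 and only an upper
    bound on the angle results. *)
Lemma angle_diff e : 0 < e ->
  \forall w \near gen p, `|D w - k * L w| <= e * `|L w|.
Proof.
move=> e0; pose H (m : {classic Lambda M}) w : R :=
  if m != l then (coef P m - coef Q m) * F m w else 0.
have DH w : D w - k * L w = \sum_(m <- undup J) H m w.
  rewrite /D /angle_at -sumrB.
  rewrite (bigD1_seq (l : {classic Lambda M})) ?undup_uniq ?mem_undup //=.
  rewrite [k * _]mulrBl [X in X - _ = _]addrC addrK big_mkcond /=.
  by apply: eq_bigr => m _; rewrite /H mulrBl.
have := @sum_small p _ (undup J) H L.
move=> /(_ _ _ e0) h; apply: filterS (h _) => [w|m]; first by rewrite DH.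
rewrite mem_undup => mJ e1 e10; rewrite /H.
have triv : \forall w \near gen p, `|0 : R| <= e1 * `|L w|.
  by apply: filterE => w; rewrite normr0 mulr_ge0 // ltW.
case: eqP => //= ne.
have [//|lm|ml] := lam_total l m; first by move=> e2; case: ne.
  have [_ [co _]] := br; rewrite (co _ lm) subrr.
  by apply: filterS triv => w; rewrite mul0r.
move: ml => /(lam_lt_scale prec_wo); rewrite eF // eF // => ml.
pose c := `|coef P m - coef Q m| + 1.
have c0 : 0 < c by rewrite ltr_wpDl.
move: (ml _ (divr_gt0 e10 c0)); rewrite le_mag_hval; apply: filterS => w h1.
rewrite normrM; apply: (@le_trans _ _ (c * (e1 / c * `|L w|))).
  by apply: ler_pM => //; rewrite /c lerDl.
by rewrite mulrA mulrCA divff ?mulr1 // gt_eqF.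
Qed.

Lemma sin_upper : exists2 C : R, 0 < C &
  \forall w \near gen p, sin (D w / 2) ^+ 2 <= C * `|L w| ^+ 2.
Proof.
have k0 : 0 < `|k| + 1 by rewrite ltr_wpDl.
exists ((`|k| + 1) ^+ 2); first exact: exprn_gt0.
apply: filterS (angle_diff ltr01) => w h.
rewrite -exprMn -[leLHS]real_normK ?num_real // ler_pXn2r ?nnegrE ?normr_ge0 //.
  apply: le_trans (sin_le _) _; rewrite normrM.
  have : `|D w| <= `|k * L w| + `|D w - k * L w|.
    by rewrite -{1}[D w](subrKC (k * L w)) ler_normD.
  rewrite (normrM k) (@ger0_norm _ 2^-1) ?invr_ge0 // => h1.
  apply: (@le_trans _ _ `|D w|); first by have := normr_ge0 (D w); lra.
  by rewrite mulrDl; lra.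
Qed.

(** Two regimes. At [lam0] the scale is 1 and the angle is infinitely close to the difference of two
    distinct points of the circle. Below it the scale is infinitesimal and the sine is comparable to
    its argument. *)
Lemma sin_lower : differ P Q l -> exists2 c : R, 0 < c &
  \forall w \near gen p, c * `|L w| ^+ 2 <= sin (D w / 2) ^+ 2.
Proof.
move=> [t [u [ht hu tu]]].
have kE : k = t - u by rewrite /k /coef ht hu.
have k0 : 0 < `|k| by rewrite kE normr_gt0 subr_eq0.
have [[l0 _ _ _ _] _] := br.
have eL : scale l = hval p L by apply: eF.
case: l0 => [el|ll0].
  have tc : in_circle t by apply: (@fn_circle _ _ _ _ P); rewrite -el.
  have uc : in_circle u by apply: (@fn_circle _ _ _ _ Q); rewrite -el.
  have [c [e [c0 e0 hc]]] := circle_sin tc uc tu.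
  exists (c ^+ 2); first exact: exprn_gt0.
  have L1 : \forall w \near gen p, L w = 1.
    by apply/hval_eq; rewrite -eL el scale_lam0 -hstd_hval.
  have e2 : 0 < e / 2 by rewrite divr_gt0.
  apply: filterS (filterI L1 (angle_diff e2)) => w [/= -> h].
  rewrite normr1 expr1n mulr1 -[leRHS]real_normK ?num_real //.
  rewrite ler_pXn2r ?nnegrE ?normr_ge0 ?(ltW c0) //; apply: hc.
  by move: h; rewrite normr1 !mulr1 kE => /le_lt_trans; apply; lra.
have [e e0 he] := sin_ge R.
(* [|D|] is at least [|k L| / 2]; the half-angle and [sin_ge] each cost a further factor 2. *)
exists ((`|k| / 8) ^+ 2); first by rewrite exprn_gt0 // divr_gt0.
have q0 : 0 < e / (`|k| + 1) by rewrite divr_gt0 // ltr_wpDl.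
move: ll0 => /(lam_lt_scale prec_wo)/(_ _ q0); rewrite scale_lam0 eL (hstd_hval p).
rewrite le_mag_hval => Ls.
(* The first entry keeps [|D|] above [|k L| / 2], the second keeps it below [(|k| + 1) |L|], hence
   below [e]. *)
have k2 : 0 < Num.min (`|k| / 2) 1 by rewrite lt_min divr_gt0 //= ltr01.
apply: filterS (filterI Ls (angle_diff k2)) => w [/=].
rewrite normr1 mulr1 ler_pdivlMr ?ltr_wpDl // => h1 h2.
have h3 : `|D w - k * L w| <= `|k| / 2 * `|L w|.
  by apply: le_trans h2 _; rewrite ler_wpM2r // ge_min lexx.
have h4 : `|D w - k * L w| <= `|L w|.
  by apply: le_trans h2 _; rewrite ler_piMl // ge_min lexx orbT.
have h5 : `|D w| <= `|k * L w| + `|D w - k * L w|.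
  by rewrite -{1}[D w](subrKC (k * L w)) ler_normD.
have h6 : `|k * L w| <= `|D w| + `|D w - k * L w|.
  by rewrite -{1}[k * L w](subKr (D w)) ler_normB.
rewrite (normrM k) in h5 h6.
have half : `|D w / 2| = `|D w| / 2 by rewrite normrM (@ger0_norm _ 2^-1) ?invr_ge0.
have small : `|D w / 2| < e.
  by rewrite half; rewrite mulrDr mulr1 in h1; have := normr_ge0 (D w); lra.
have := he _ small; rewrite half => h7.
rewrite -exprMn -[leRHS]real_normK ?num_real // ler_pXn2r ?nnegrE ?normr_ge0 //.
  by lra.
Qed.

Lemma low_bounds (N : Fpair eps prec) : (low N : {classic Lambda M}) \in J ->
  lam_le (low N) l ->
  \forall w \near gen p, [/\ F (low N) w != 0, 0 <= - ln `|F (low N) w| &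
     - ln `|L w| <= - ln `|F (low N) w| ].
Proof.
move=> NJ Nl; have eN : scale (low N) = hval p (F (low N)) by apply: eF.
have N0 := scale_near0 eN; have N1 := scale_le1 prec_wo eN (low_le N).
have NL : \forall w \near gen p, `|F (low N) w| <= `|L w|.
  case: Nl => [e|]; first by apply: filterE => w; rewrite /L -e.
  move=> /(lam_lt_scale prec_wo)/(_ _ ltr01); rewrite eN eF // le_mag_hval.
  by apply: filterS => w; rewrite mul1r.
apply: filterS (filterI N0 (filterI N1 NL)) => w [/= h0 [h1 h2]].
have f0 : 0 < `|F (low N) w| by rewrite normr_gt0.
split=> //; first by rewrite oppr_ge0 ln_le0.
by rewrite lerN2 ler_ln // posrE (lt_le_trans f0).
Qed.

Lemma config_dist_close : exists K, \forall w \near gen p,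
  `|d w - (- ln `|F (low P) w| + - ln `|F (low Q) w| - (- ln `|L w|) *+ 2)| <= K.
Proof.
have [[l0 _ _ Pl Ql] [_ dis]] := br.
have bP := low_bounds PJ Pl; have bQ := low_bounds QJ Ql.
have eL : scale l = hval p L by apply: eF.
have L0 := scale_near0 eL.
have [C C0 hC] := sin_upper.
have ed w : 0 <= - ln `|F (low P) w| -> 0 <= - ln `|F (low Q) w| ->
    cosh (d w) = cosh_form (- ln `|F (low P) w|) (- ln `|F (low Q) w|) (D w).
  by move=> h1 h2; rewrite cosh_dist_polar !max_r.
have sq w : L w != 0 -> expR (- ((- ln `|L w|) *+ 2)) = `|L w| ^+ 2.
  move=> h; rewrite mulNrn opprK -mulr_natl expRM_natl lnK // posrE normr_gt0 //.
have upper : \forall w \near gen p,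
    d w <= - ln `|F (low P) w| + - ln `|F (low Q) w| - (- ln `|L w|) *+ 2
           + ln (2 * (expR (0 *+ 2) + C)).
  apply: filterS (filterI (filterI bP bQ) (filterI L0 hC)).
  move=> w [[/= [h1 h2 h3] [h4 h5 h6]] [h7 h8]].
  apply: (cosh_form_le (a := D w)) => //; rewrite ?addr0 //; first exact: ed.
  by rewrite sq.
have [K hK] : exists K, \forall w \near gen p,
    - ln `|F (low P) w| + - ln `|F (low Q) w| - (- ln `|L w|) *+ 2 - K <= d w.
  case: dis => [/sin_lower [c c0 hc]|[_ lPQ]].
    exists (- ln (c / 2)).
    apply: filterS (filterI (filterI bP bQ) (filterI L0 hc)).
    move=> w [[/= [h1 h2 h3] [h4 h5 h6]] [h7 h8]].
    rewrite opprK; apply: (cosh_form_ge_half (a := D w)) => //; last by rewrite sq.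
      exact: dist_plane_ge0.
    exact: ed.
  (* Here [d >= |r1 - r2|] suffices: [- ln |L|] is one of the two radii, so the expression to be
     bounded is a difference of radii. *)
  exists 0; apply: filterS (filterI bP bQ) => w [/= [h1 h2 h3] [h4 h5 h6]].
  have d0 : 0 <= d w by exact: dist_plane_ge0.
  have cg := cosh_form_ge (D w) h2 h5; rewrite -ed // in cg.
  rewrite subr0; case: lPQ => e.
    rewrite /L e; apply: le_trans (_ : _ <= - ln `|F (low Q) w| - - ln `|F (low P) w|) _.
      by rewrite mulr2n; lra.
    by apply: cosh_le => //; rewrite -coshN opprB.
  rewrite /L e; apply: le_trans (_ : _ <= - ln `|F (low P) w| - - ln `|F (low Q) w|) _.
    by rewrite mulr2n; lra.
  exact: cosh_le.
pose T w := - ln `|F (low P) w| + - ln `|F (low Q) w| - (- ln `|L w|) *+ 2.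
exists (Num.max K (ln (2 * (expR (0 *+ 2) + C)))).
apply: filterS (filterI upper hK) => w [/=].
rewrite -/(T w); move: (T w) (d w) (ln _) => b a c h1 h2.
rewrite ler_norml lerNl !le_max; apply/andP; split; apply/orP; [left|right]; lra.
Qed.

Lemma config_dist_scaled : hclose p (fun w => E w * d w) (F_delta P Q).
Proof.
have [[l0 gl sl Pl Ql] _] := br.
have [K hK] := config_dist_close.
have logc (m : Lambda M) s : (m : {classic Lambda M}) \in J -> g m = s%:E ->
    hclose p (fun w => - (E w * ln `|F m w|)) s.
  move=> mJ gm; have [[_ [t]]|[]] := lam_gE eE (eF mJ); rewrite gm // => -[<-].
  by [].
have [a ga] := lam_g_fin (low_fin P); have [b gb] := lam_g_fin (low_fin Q).
rewrite /F_delta ga gb sl /=.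
(* Five errors of size at most [e / 8] add up: one for each end, two for the doubled term at [l],
   and one for [eps] times the bounded remainder. *)
move=> e e0; have e8 : 0 < e / 8 by rewrite divr_gt0.
have k0 : 0 < `|K| + 1 by rewrite ltr_wpDl.
have Es := eps_near eps_gt0 eps_inf eE (divr_gt0 e8 k0).
apply: filterS (filterI (filterI (logc _ _ PJ ga _ e8) (logc _ _ QJ gb _ e8))
  (filterI (logc _ _ lJ gl _ e8) (filterI hK Es))).
move=> w [[/= /ltr_normlP[h1 h2] /ltr_normlP[h3 h4]] [/ltr_normlP[h5 h6] [hd]]].
move=> /andP[E0 h7].
have {}hd : `|E w * (d w - (- ln `|F (low P) w| + - ln `|F (low Q) w|
    - (- ln `|L w|) *+ 2))| <= e / 8.
  rewrite normrM gtr0_norm //; apply: (@le_trans _ _ (E w * (`|K| + 1))).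
    rewrite ler_pM2l //; apply: le_trans hd _; apply: le_trans (ler_norm K) _.
    by rewrite lerDl.
  by rewrite -ler_pdivlMr // ltW.
rewrite mulrBr mulrBr mulrDr mulrnAr !mulrN in hd.
move: hd => /ler_normlP[h8 h9].
move: (E w * d w) (E w * ln `|F (low P) w|) (E w * ln `|F (low Q) w|) (E w * ln `|L w|)
  h1 h2 h3 h4 h5 h6 h8 h9 => x y z t h1 h2 h3 h4 h5 h6.
rewrite mulr2n => h8 h9.
by apply/ltr_normlP; split; lra.
Qed.

End Branch.
End Configuration.
End Pairs.

(** * The embedding *)

Section Plane.
Variable R : realType.

Lemma plane_eq (x y : plane R) : rho x = rho y -> phi x = phi y -> x = y.
Proof.
case: x y => [r a r0 ac ra] [s b s0 bc sb] /= rs ab; subst s b.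
by congr Plane; exact: Prop_irrelevance.
Qed.

Lemma code_plane_inj : injective (@code_plane R).
Proof. by move=> x y /(@kpair_inj R 0) [h1 h2]; apply: plane_eq. Qed.

Lemma plane_covers : exists c : set R -> plane R, covers c.
Proof.
(* The positive element carries the radius and the negative one the angle. *)
pose enc (x : plane R) : set R := [set expR (rho x); - expR (phi x)].
have enc_inj : injective enc.
  have neg (a b : R) : expR a <> - expR b.
    by move=> e; have := expR_gt0 a; rewrite e oppr_gt0 ltNge expR_ge0.
  move=> x y e; apply: plane_eq.
    have : enc y (expR (rho x)) by rewrite -e; left.
    by move=> [/expR_inj//|/neg].
  have : enc y (- expR (phi x)) by rewrite -e; right.
  by move=> [/esym/neg//|/oppr_inj/expR_inj].
exists (fun w => the (polar 0 0) [set x | enc x = w]) => x; exists (enc x).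
by apply: the_unique => // y /enc_inj.
Qed.

End Plane.

(** * Standard parts of scaled distances in the nonstandard plane *)

Section Asymptotic.
Variables (R : realType) (N : model R).

Lemma st_unique (x : hreal N) r :
  infinitesimal (hadd x (hopp (hstd r))) -> st x = r.
Proof. by have [p [F ->]] := hval_cover x; rewrite close_hval; exact: st_close. Qed.

(** The predicates defining the two standard parts coincide, so their default values agree as well
    when no such real exists. *)
Lemma st_ext (p : spoint N) F G :
  (forall r, hclose p F r <-> hclose p G r) -> st (hval p F) = st (hval p G).
Proof.
move=> h; exact (congr1 (the 0) (funext (fun r => propext (iff_trans
  (close_hval p F r) (iff_trans (h r) (iff_sym (close_hval p G r))))))).
Qed.

Variable eps : hreal N.

Lemma plane_cover4 (a b c d : star_plane N) : exists p E A B C D,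
  eps = hval p E /\ [/\ a = value (@code_plane_inj R) p A,
    b = value (@code_plane_inj R) p B, c = value (@code_plane_inj R) p C
    & d = value (@code_plane_inj R) p D].
Proof.
have [s sX] := plane_covers R.
have [q h] := @cover_seq R N _ _ _ (@code_plane_inj R) s sX
  {classic star_plane N} id [:: a; b; c; d].
have [A ->] := h a (mem_head _ _).
have [B ->] : exists F, b = value (@code_plane_inj R) q F.
  by apply: h; rewrite !inE eqxx ?orbT.
have [C ->] : exists F, c = value (@code_plane_inj R) q F.
  by apply: h; rewrite !inE eqxx ?orbT.
have [D ->] : exists F, d = value (@code_plane_inj R) q F.
  by apply: h; rewrite !inE eqxx ?orbT.
have [q' [E ->]] := hval_cover eps.
have [p [f [g [hf hg]]]] := value_merge q q'.
exists p, (E \o g), (A \o f), (B \o f), (C \o f), (D \o f).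
by rewrite /hval !hf !hg.
Qed.

Lemma scaled_distE (p : spoint N) E A B : hmul (hval p E) (star_dist
    (value (@code_plane_inj R) p A) (value (@code_plane_inj R) p B)) =
  hval p (fun w => E w * dist_plane (A w) (B w)).
Proof. by rewrite /star_dist ext2_value hmulE. Qed.

Lemma scaled_distxx (x : star_plane N) : infinitesimal (hmul eps (star_dist x x)).
Proof.
have [p [E [A [B [_ [_ [-> [-> _ _ _]]]]]]]] := plane_cover4 x x x x.
rewrite scaled_distE infinitesimal_hval => e e0; apply: filterE => w.
by rewrite dist_planexx mulr0 normr0.
Qed.

Lemma asympt_near_rep (a : asympt_pre eps) :
  asympt_near a (rep (cls (@asympt_near R N eps) a)).
Proof.
have := repP (cls (@asympt_near R N eps) a).
move=> /(congr1 sval) /= /(congr1 (@^~ (rep (cls (@asympt_near R N eps) a)))) <-.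
exact: scaled_distxx.
Qed.

(** By the triangle inequality the two scaled distances differ by an infinitesimal, and [st_ext]
    concludes whether they are finite or not. *)
Lemma st_scaled_dist (a b a' b' : star_plane N) :
  infinitesimal (hmul eps (star_dist a a')) ->
  infinitesimal (hmul eps (star_dist b b')) ->
  st (hmul eps (star_dist a' b')) = st (hmul eps (star_dist a b)).
Proof.
have [p [E [A [B [A' [B' [-> [-> -> -> ->]]]]]]]] := plane_cover4 a b a' b'.
rewrite !scaled_distE !infinitesimal_hval => ha hb.
have key e : 0 < e -> \forall w \near gen p,
    `|E w * dist_plane (A w) (B w) - E w * dist_plane (A' w) (B' w)| < e.
  move=> e0; have e2 : 0 < e / 2 by rewrite divr_gt0.
  apply: filterS (filterI (ha _ e2) (hb _ e2)) => w [/=].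
  rewrite !normrM -mulrBr normrM.
  rewrite (ger0_norm (dist_plane_ge0 _ _)) (ger0_norm (dist_plane_ge0 _ _)).
  move=> h1 h2; apply: (@le_lt_trans _ _ (`|E w| * dist_plane (A w) (A' w) +
    `|E w| * dist_plane (B w) (B' w))); last by lra.
  rewrite -mulrDr; apply: ler_wpM2l => //.
  have t1 := dist_plane_triangle (A w) (A' w) (B w).
  have t2 := dist_plane_triangle (A' w) (B' w) (B w).
  have t3 := dist_plane_triangle (A' w) (A w) (B' w).
  have t4 := dist_plane_triangle (A w) (B w) (B' w).
  rewrite (dist_planeC (B' w) (B w)) in t2; rewrite (dist_planeC (A' w) (A w)) in t3.
  by rewrite ler_norml; apply/andP; split; lra.
apply: st_ext => r; split=> h e e0;
  have e2 : 0 < e / 2 by rewrite divr_gt0.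
  apply: filterS (filterI (h _ e2) (key _ e2)) => w [/= /ltr_normlP[h1 h2]].
  by move=> /ltr_normlP[h3 h4]; apply/ltr_normlP; split; lra.
apply: filterS (filterI (h _ e2) (key _ e2)) => w [/= /ltr_normlP[h1 h2]].
by move=> /ltr_normlP[h3 h4]; apply/ltr_normlP; split; lra.
Qed.

Lemma asympt_dist_cls (a b : asympt_pre eps) :
  asympt_dist (cls _ a) (cls _ b) = st (hmul eps (star_dist (sval a) (sval b))).
Proof. exact: st_scaled_dist (asympt_near_rep a) (asympt_near_rep b). Qed.

End Asymptotic.

Lemma seq_ultrafilter (T : eqType) : exists U : set_system (seq T),
  UltraFilter U /\ forall t, \forall J \near U, t \in J.
Proof.
pose base (K : seq T) := [set J : seq T | {subset K <= J}].
have FF : Filter (filter_from setT base).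
  apply: filter_from_filter; first by exists [::].
  move=> K L _ _; exists (K ++ L) => // J h; split=> t tK; apply: h.
    by rewrite mem_cat tK.
  by rewrite mem_cat tK orbT.
have PF : ProperFilter (filter_from setT base).
  by apply: filter_from_proper => K _; exists K.
have [U [UU sU]] := ultraFilterLemma PF.
exists U; split=> // t; apply: sU; exists [:: t] => // J; apply.
by rewrite mem_head.
Qed.

(** * Families of finite configurations and the isometry *)

Section Embedding.
Variables (R : realType) (M : model R) (eps : hreal M).
Hypotheses (eps_gt0 : hlt (hstd 0) eps) (eps_inf : infinitesimal eps).
Variable prec : hreal M -> hreal M -> Prop.
Hypothesis prec_wo : initial_well_order prec.
Local Notation T := {classic Lambda M}.

(** The option type adds [eps], as [None], to the finite list of scales, so that all become values
    at one point. *)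
Lemma frame_exists (J : seq T) :
  exists f : spoint M * (set R -> R) * (Lambda M -> set R -> R),
    eps = hval f.1.1 f.1.2 /\ forall l : T, l \in J -> scale prec l = hval f.1.1 (f.2 l).
Proof.
pose f (o : option T) := if o is Some l then scale prec l else eps.
have [p h] := @hcover_seq R M _ f (None :: map Some J).
have [E eE] := h None (mem_head _ _).
have hF (l : T) : exists F, l \in J -> scale prec l = hval p F.
  have [lJ|_] := boolP (l \in J); last by exists (fun=> 0).
  have [|F eF] := h (Some l); last by exists F.
  by rewrite inE /= map_f.
have [F eF] := choice hF.
by exists (p, E, F).
Qed.

Definition frame J := projT1 (cid (frame_exists J)).

Lemma frame_eps J : eps = hval (frame J).1.1 (frame J).1.2.
Proof. exact: (projT2 (cid (frame_exists J))).1. Qed.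

Lemma frame_scale J (l : T) : l \in J -> scale prec l = hval (frame J).1.1 ((frame J).2 l).
Proof. exact: (projT2 (cid (frame_exists J))).2. Qed.

(** The radius is meaningful once [low P] belongs to [J]; the other indices are negligible for the
    ultrafilter. *)
Definition approx (P : Fpair eps prec) (J : seq T) : star_plane M :=
  value (@code_plane_inj R) (frame J).1.1 (config_point (frame J).2 J P).

Lemma approx_rho P J K : (low P : T) \in J -> lam_g eps prec (low P) = K%:E ->
  hlt (habs (hmul eps (star_rho (approx P J)))) (hstd (`|K| + 1)).
Proof.
move=> PJ gP; rewrite /star_rho ext1_value.
rewrite {1}(frame_eps J) (hstd_hval (frame J).1.1) !hvalE hlt_hval.
have [[_ [r]]|[]] := lam_gE (frame_eps J) (frame_scale PJ); rewrite gP // => -[<-].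
move=> /(_ _ ltr01); apply: filterS => w h.
rewrite /= rho_polar normrM.
apply: (@le_lt_trans _ _ `|(frame J).1.2 w * ln `|(frame J).2 (low P) w| |).
  rewrite normrM ler_wpM2l //; set x := ln _.
  by case: (leP 0 (- x)) => _; rewrite ?normrN // normr0.
have := ler_normB (- ((frame J).1.2 w * ln `|(frame J).2 (low P) w|) - K) (- K).
by rewrite opprK subrK !normrN; lra.
Qed.

Lemma approx_dist P Q J l r : (low P : T) \in J -> (low Q : T) \in J ->
  (l : T) \in J -> branching P Q l r ->
  forall e, 0 < e -> hlt (habs (hadd (hmul eps (star_dist (approx P J) (approx Q J)))
    (hopp (hstd (F_delta P Q))))) (hstd e).
Proof.
move=> PJ QJ lJ br.
rewrite -/(infinitesimal _) {1}(frame_eps J) scaled_distE close_hval.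
exact: (config_dist_scaled eps_gt0 eps_inf prec_wo (frame_eps J) (@frame_scale J)
  PJ QJ lJ br).
Qed.

End Embedding.

Theorem theorem4p2 (R : realType) (M : model R) (eps : hreal M)
    (eps_gt0 : hlt (hstd 0) eps) (eps_inf : infinitesimal eps)
    (prec : hreal M -> hreal M -> Prop) (prec_wo : initial_well_order prec) :
  exists (M' : model R) (j : elementary_extension M M')
         (F : F_space eps prec -> asymptotic_space (hemb j eps)),
    forall x y, asympt_dist (F x) (F y) = F_dist x y.
Proof.
have [U [UU Uin]] := seq_ultrafilter {classic Lambda M}.
have [c cX] := plane_covers R.
pose N := ultrapower M UU; pose j := ultrapower_ext M UU.
pose hfam (x : seq {classic Lambda M} -> hreal M) : hreal N := family_cls UU x.
have e1 (f : R -> R) x : ext1 f (hfam x) = hfam (fun J => ext1 f (x J)).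
  exact: (ext1_family UU (@real_code_inj R) (@real_covers R)).
have e2 (f : R -> R -> R) x y :
    ext2 f (hfam x) (hfam y) = hfam (fun J => ext2 f (x J) (y J)).
  exact: (ext2_family UU (@real_code_inj R) (@real_covers R)).
have he : hemb j eps = hfam (fun=> eps) by exact: hemb_family.
have hs r : hstd r = hfam (fun=> hstd r) by exact: hstd_family.
pose X (P : Fpair eps prec) : star_plane N := family_cls UU (approx P).
have Xfin P : hfinite (hmul (hemb j eps) (star_rho (X P))).
  have [K gP] := lam_g_fin (low_fin P); exists (`|K| + 1).
  have -> : star_rho (X P) = hfam (fun J => star_rho (approx P J)).
    exact: (ext1_family UU (@code_plane_inj R) cX).
  rewrite he hs /habs /hmul e2 e1; apply: hlt_family.
  by apply: filterS (Uin (low P)) => J PJ; exact: approx_rho.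
pose pre P : asympt_pre (hemb j eps) := exist _ (X P) (Xfin P).
(* The map uses the representatives that [F_dist] also uses, so the claim reduces to two pairs;
   [asympt_dist_cls] handles the representatives on the other side. *)
exists N, j, (fun x => cls _ (pre (rep x))) => x y.
rewrite asympt_dist_cls /F_dist; move: (rep x) (rep y) => P Q /=.
apply: st_unique => e e0.
have [l [r br]] := branching_exists eps_gt0 eps_inf prec_wo P Q.
have -> : star_dist (X P) (X Q) = hfam (fun J => star_dist (approx P J) (approx Q J)).
  exact: (ext2_family UU (@code_plane_inj R) cX).
rewrite he !hs /habs /hadd /hopp /hmul !(e1, e2); apply: hlt_family.
apply: filterS (filterI (Uin (low P)) (filterI (Uin (low Q)) (Uin l))).
by move=> J [PJ [QJ lJ]]; exact: approx_dist lJ br _ e0.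
Qed.
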